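(* Let $n\ge 2$, $d\ge 1$, and let $M=\binom{n+d}{d}$. There is a polynomial map $\phi:\mathbb{R}^d\to\mathbb{R}^M$, depending only on $n$ and $d$ (namely the map whose components are all monomials $x_1^{s_1}\cdots x_d^{s_d}$ with $0\le s_1+\dots+s_d\le n$), such that the following holds. For every integer $k\ge0$, every compact $\Omega\subset\mathbb{R}^d$, every totally symmetric $\mathcal{C}^k$ function $f:\Omega^n\to\mathbb{R}$ and every $\epsilon>0$, there exists a polynomial $\rho:\mathbb{R}^M\to\mathbb{R}$ such that the function $P(\boldsymbol{x})=\rho\left(\sum_{i=1}^n\phi(\boldsymbol{x}_i)\right)$ satisfies $$\|f-P\|_{\mathcal{C}^k(\Omega^n)}<\epsilon .$$
   Context: Points of $(\mathbb{R}^d)^n$ are written $\boldsymbol{x}=(\boldsymbol{x}_1,\dots,\boldsymbol{x}_n)$ with $\boldsymbol{x}_i\in\mathbb{R}^d$. For $\sigma$ in the symmetric group $\mathcal{S}_n$, $\sigma.\boldsymbol{x}:=(\boldsymbol{x}_{\sigma(1)},\dots,\boldsymbol{x}_{\sigma(n)})$. A function $f$ is totally symmetric if $f(\sigma.\boldsymbol{x})=f(\boldsymbol{x})$ for all $\sigma\in\mathcal{S}_n$ and all $\boldsymbol{x}$ in its domain. For compact $V\subset(\mathbb{R}^d)^n$, pick any open set $U$ with $V\subset U\subseteq(\mathbb{R}^d)^n$ and put $\mathcal{C}^k(V)=\{F|_V: F\in\mathcal{C}^k(U)\}$, where $\mathcal{C}^k(U)$ is the set of $k$ times continuously differentiable real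 functions on $U$; this space is regarded as independent of the choice of $U$. The norm is given by the maxima of the continuous derivatives up to order $k$, restricted to $V$: $$\|p\|_{\mathcal{C}^k(V)}:=\sum_{|\alpha|\le k}\max_{\boldsymbol{x}\in V}|(D^\alpha p)(\boldsymbol{x})|,$$ with $\alpha\in\mathbb{Z}_{\ge0}^{dn}$ a multi-index.
   Formalization: Since the values on Ω^n need not determine the derivatives there, the C^k(Ω^n) norm is taken as the infimum of the displayed sum of maxima over all C^k extensions to open neighbourhoods; it equals the displayed formula whenever the derivatives are determined. *)

(* Defs.v *)
From HB Require Import structures.
From mathcomp Require Import all_boot all_order all_algebra all_fingroup.
From mathcomp Require Import all_classical all_reals all_analysis.
From mathcomp Require mpoly.

Set Implicit Arguments.
Unset Strict Implicit.
Unset Printing Implicit Defensive.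

Import Order.TTheory GRing.Theory Num.Theory.
Import numFieldNormedType.Exports.

Local Open Scope classical_set_scope.
Local Open Scope ring_scope.

(* A point (x_1, ..., x_n) of (R^d)^n is an n x d matrix whose i-th row is x_i. *)

Section SmoothFunctions.
Context {R : realType} {n d : nat}.
Implicit Types (U V W : set 'M[R]_(n, d)) (F G f : 'M[R]_(n, d) -> R).

Definition partial (ij : 'I_n * 'I_d) F : 'M[R]_(n, d) -> R :=
  fun x => 'D_(delta_mx ij.1 ij.2) F x.

(* Only used on functions of class C^|a|, for which the order in which the
   partial derivatives are taken is immaterial. *)
Definition mderive (a : 'I_n * 'I_d -> nat) F : 'M[R]_(n, d) -> R :=
  foldr (fun ij G => iter (a ij) (partial ij) G) F (enum {: 'I_n * 'I_d}).

Fixpoint Ck_on k U F : Prop :=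
  {in U, continuous F} /\
  if k is k'.+1 then
    forall ij, (forall x, U x -> derivable F x (delta_mx ij.1 ij.2)) /\
               Ck_on k' U (partial ij F)
  else True.

(* (U, F) is a C^k extension of the restriction of f to V. *)
Definition Ck_extension k V f U F : Prop :=
  [/\ open U, V `<=` U, Ck_on k U F & {in V, F =1 f}].

(* f restricted to V belongs to C^k(V); values of f outside V play no role. *)
Definition Ck k V f : Prop := exists U F, Ck_extension k V f U F.

(* The multi-indices of order at most k are among the a : _ -> {0, ..., k}. *)
Definition order (k : nat) (a : {ffun 'I_n * 'I_d -> 'I_k.+1}) : nat :=
  (\sum_ij a ij)%N.

(* For compact V the supremum is a maximum, and it is 0 when V is empty. *)
Definition Ck_sum k V F : R :=
  \sum_(a : {ffun 'I_n * 'I_d -> 'I_k.+1} | (order a <= k)%N)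
    sup [set `|mderive (fun ij => a ij) F x| | x in V].

(* f is only given on V, while Ck_sum refers to the derivatives on V of an
   extension of f; the infimum over all C^k extensions makes the norm depend on
   f restricted to V alone (it is +oo if f is not in C^k(V)). *)
Definition Ck_norm k V f : \bar R :=
  ereal_inf [set (Ck_sum k V UF.2)%:E
            | UF in [set UF | Ck_extension k V f UF.1 UF.2]].

Lemma eq_partial W ij F G : open W ->
  {in W, F =1 G} -> {in W, partial ij F =1 partial ij G}.
Proof.
move=> oW FG x; rewrite inE => Wx; apply: near_eq_derive.
have : nbhs x W by exact: open_nbhs_nbhs.
by apply: filterS => y Wy; apply: FG; rewrite inE.
Qed.

Lemma eq_mderive W a F G : open W ->
  {in W, F =1 G} -> {in W, mderive a F =1 mderive a G}.
Proof.
move=> oW FG; rewrite /mderive; elim: (enum _) => //= ij s IH.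
by elim: (a ij) => //= m; exact: eq_partial.
Qed.

Lemma Ck_on_le k l U F : (k <= l)%N -> Ck_on l U F -> Ck_on k U F.
Proof.
elim: k l F => [|k IH] [|l] F //=; first by move=> _ [].
move=> kl [cF pF]; split=> // ij; have [dF CF] := pF ij.
by split=> //; exact: IH CF.
Qed.

Lemma Ck_on_mderive k U a F :
  Ck_on (\sum_ij a ij + k)%N U F -> Ck_on k U (mderive a F).
Proof.
rewrite /mderive -big_enum /=; elim: (enum _) k => [|ij s IH] k /=.
  by rewrite big_nil.
rewrite big_cons addnAC addnC => /IH.
move: (foldr _ _ _) => {IH}G.
elim: (a ij) k => [|m IH] k //; rewrite addSn -addnS iterS => /IH /= [_ pG].
by have [] := pG ij.
Qed.

(* When the values on V determine the derivatives on V, the norm is the sum of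
   the maxima of the derivatives of any extension. *)
Lemma Ck_normE k V f U F : V `<=` closure V° ->
  Ck_extension k V f U F -> Ck_norm k V f = (Ck_sum k V F)%:E.
Proof.
move=> VV extF; rewrite /Ck_norm.
have sumE U' F' : Ck_extension k V f U' F' -> Ck_sum k V F' = Ck_sum k V F.
  case: extF => oU VU CF Ff [oU' VU' CF' F'f].
  apply: eq_bigr => a ak; congr (sup _); apply: eq_imagel => x Vx.
  congr (`|_|); set D' := mderive _ F'; set D := mderive _ F.
  have cont W H : V `<=` W -> Ck_on k W H ->
      mderive (fun ij => a ij) H @ x --> mderive (fun ij => a ij) H x.
    move=> VW CH; have : Ck_on 0 W (mderive (fun ij => a ij) H).
      by apply: Ck_on_mderive; rewrite addn0; exact: Ck_on_le CH.
    by case=> + _; apply; rewrite inE; exact: VW.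
  have cD := cont _ _ VU CF; have cD' := cont _ _ VU' CF'.
  have DD : {in (V° : set 'M[R]_(n, d)), D' =1 D}.
    apply: eq_mderive; first exact: open_interior.
    move=> y; rewrite inE => /interior_subset Vy.
    by rewrite Ff ?F'f ?inE.
  apply/eqP; rewrite -subr_eq0; apply/negPn/negP => neq0.
  have cB : (D' \- D) @ x --> (D' \- D) x by exact: cvgB cD' cD.
  have /(VV _ Vx) [y [Vy /=]] : nbhs x ((D' \- D) @^-1` [set r | r != 0]).
    by apply: cB; apply: open_nbhs_nbhs; split=> //; exact: open_neq.
  by rewrite /= DD ?inE // subrr eqxx.
rewrite [X in ereal_inf X](_ : _ = [set (Ck_sum k V F)%:E]) ?ereal_inf1 //.
apply/seteqP; split=> [_ [[U' F'] /= e <-]|_ ->] /=; first by rewrite (sumE _ _ e).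
by exists (U, F).
Qed.

Definition totally_symmetric V f : Prop :=
  forall (s : 'S_n) x, V x -> f (row_perm s x) = f x.

Definition cpower (Omega : set 'rV[R]_d) : set 'M[R]_(n, d) :=
  [set x | forall i, Omega (row i x)].
End SmoothFunctions.

(* The components of phi are exactly the monomials of total degree at most n
   in d variables, each occurring once; s lists their exponents. *)
Definition monomial_map (R : realType) (n d M : nat)
    (phi : 'rV[R]_d -> 'rV[R]_M) : Prop :=
  exists s : 'I_M -> {ffun 'I_d -> nat},
    [/\ injective s,
        forall a : {ffun 'I_d -> nat},
          (\sum_(i < d) a i <= n)%N <-> exists j, s j = a &
        forall x j, phi x 0 j = \prod_(i < d) x 0 i ^+ s j i].

Definition poly_eval (R : realType) (M : nat) (rho : mpoly.mpoly M R)
    (y : 'rV[R]_M) : R :=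
  mpoly.meval (fun j => y 0 j) rho.

(* Main.v *)
Require Import Defs.
From mathcomp Require Import all_boot all_order all_algebra all_fingroup.
From mathcomp Require Import all_classical all_reals all_analysis.
From mathcomp Require Import (canonicals) mpoly.
From mathcomp Require Import ring lra zify.

Set Implicit Arguments.
Unset Strict Implicit.
Unset Printing Implicit Defensive.

Import Order.TTheory GRing.Theory Num.Theory.
Import numFieldNormedType.Exports.

Local Open Scope classical_set_scope.
Local Open Scope ring_scope.

(** The functions rho (sum_i phi (x_i)) form the algebra generated by the power
    sums of the monomials of degree at most n. For functions y_1, ..., y_m on
    {1..n}, sums of y_1 (i_1) ... y_m (i_m) over distinct indices satisfy a
    Newton-like recursion, which expresses symmetrized products by power sums
    and, since there are no n+1 distinct indices, expresses the power sums of
    degree above n by those of lower degree. Hence every symmetric polynomial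
    lies in the algebra.

    Analytically, f is extended to a symmetric function G of class C^k on the
    whole space by a cutoff and by averaging over permutations. The tensor
    product Bernstein polynomials of G on a large box are symmetric. Their
    derivatives are, up to a factor tending to 1, Bernstein polynomials of the
    difference quotients of G, which are values of the derivatives of G at nearby
    points; so they converge in C^k on the box. *)

(** * Sums over distinct indices *)

(** Two obstacles shape the analytic half. The nodes of a Bernstein polynomial fill a box, while [f]
    is given on the power of [Omega] only, so one function [G] on the whole space has to replace
    [f]. This costs nothing in the norm: it is an infimum over extensions, and [G] minus the
    approximant is one of them. Moreover, differentiation lowers the degree of a Bernstein
    polynomial but keeps its grid, so degree and grid are independent parameters, and the estimates
    allow degrees a bounded amount below the grid size. Bernstein polynomials serve here because
    they are built from values on a grid that every row permutation preserves, hence inherit the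
    symmetry of [G] exactly.

    In the algebraic half, symmetric polynomials are never expanded in monomials. A Bernstein
    polynomial is a sum of products of one-variable polynomials, and symmetrizing such a product
    gives a sum over [n] distinct indices. Only the power sums of single monomials need the bound on
    the degree; solving for those of high degree divides by a factorial, which is possible over the
    reals. *)

Fixpoint merges (T : Type) (op : T -> T -> T) z ys : seq (seq T) :=
  if ys is y :: ys' then (op y z :: ys') :: map (cons y) (merges op z ys')
  else [::].

Lemma map_merges (T T' : Type) (f : T -> T') op op' z ys :
  (forall a b, f (op a b) = op' (f a) (f b)) ->
  map (map f) (merges op z ys) = merges op' (f z) (map f ys).
Proof.
move=> fop; by elim: ys => //= y ys <-; rewrite fop -!map_comp; congr (_ :: _).
Qed.

Lemma size_merges (T : Type) (op : T -> T -> T) z ys :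
  size (merges op z ys) = size ys.
Proof. by elim: ys => //= y ys IH; rewrite size_map IH. Qed.

Lemma merges_ind (T : eqType) (op : T -> T -> T) (P : seq T -> Prop) z ys :
  (forall ys1 y ys2, ys = ys1 ++ y :: ys2 -> P (ys1 ++ op y z :: ys2)) ->
  {in merges op z ys, forall w, P w}.
Proof.
elim: ys P => [|y ys IH] P H w; first by rewrite in_nil.
rewrite /= inE => /orP[/eqP->|/mapP[w' w'm ->]]; first exact: (H [::]).
apply: (IH (fun u => P (y :: u)) _ w' w'm) => u1 v u2 e.
by apply: (H (y :: u1)); rewrite e.
Qed.

Section InjectiveSums.
Context {R : comNzRingType} {n : nat}.
Implicit Types (S : {set 'I_n}) (y z : 'I_n -> R) (ys : seq ('I_n -> R)).

Definition mulf y z := fun i => y i * z i.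

(** When the [ys] are powers of one variable and [S] is empty, this is an augmented monomial
    symmetric function. The set [S] of indices already used turns it into a recursion over one index
    at a time. *)
Fixpoint inj_sum S ys : R :=
  if ys is y :: ys' then \sum_(i | i \notin S) y i * inj_sum (i |: S) ys' else 1.

(** An index for [z] outside [S] either avoids all the indices chosen for [ys] or equals exactly one
    of them; the second case multiplies [z] into the factor at that place. *)
Lemma inj_sum_cons S z ys :
  inj_sum S (z :: ys) = (\sum_(i | i \notin S) z i) * inj_sum S ys
                        - \sum_(w <- merges mulf z ys) inj_sum S w.
Proof.
elim: ys S => [|y ys IH] S.
  by rewrite big_nil subr0 /= mulr1; apply: eq_bigr => i _; rewrite mulr1.
rewrite big_cons big_map.
transitivity (\sum_(k | k \notin S) y k * inj_sum (k |: S) (z :: ys)).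
  rewrite /=; under eq_bigr => i _ do rewrite mulr_sumr.
  under [RHS]eq_bigr => i _ do rewrite mulr_sumr.
  rewrite (exchange_big_dep (fun k => k \notin S)) /=; last first.
    by move=> i k _; rewrite !inE negb_or => /andP[].
  apply: eq_bigr => k kS; apply: eq_big => [i|i _].
    by rewrite !inE !negb_or kS andbT andbC eq_sym.
  by rewrite mulrCA finset.setUCA.
transitivity (\sum_(k | k \notin S)
   (y k * inj_sum (k |: S) ys * (\sum_(i | i \notin S) z i)
    - (y k * z k) * inj_sum (k |: S) ys
    - \sum_(w <- merges mulf z ys) y k * inj_sum (k |: S) w)).
  (* The sum of [z] over the complement of [k |: S] lacks the term [z k]; this term is the merge of
     [z] with the head [y]. *)
  apply: eq_bigr => k kS; rewrite IH [in RHS](bigD1 k) //= -mulr_sumr.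
  rewrite (eq_bigl (fun i => (i \notin S) && (i != k))); last first.
    by move=> i; rewrite !inE negb_or andbC.
  ring.
rewrite big_split /= big_split /= !sumrN -mulr_suml exchange_big /=.
by rewrite opprD addrA [X in X - _ - _]mulrC.
Qed.

Lemma inj_sum_oversize S ys : (n < #|S| + size ys)%N -> inj_sum S ys = 0.
Proof.
elim: ys S => [|y ys IH] S /=.
  by rewrite addn0 ltnNge -[X in (_ <= X)%N]card_ord max_card.
move=> nS; rewrite big1 // => i iS.
by rewrite IH ?mulr0// cardsU1 iS add1n addSn -addnS.
Qed.

End InjectiveSums.

Section PermutationSums.
Context {R : comNzRingType} {n : nat}.

Let image (s : 'S_n) := [seq s i | i <- enum 'I_n].

Lemma size_image_perm (s : 'S_n) : size (image s) = n.
Proof. by rewrite size_map size_enum_ord. Qed.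

Lemma uniq_image_perm (s : 'S_n) : uniq (image s).
Proof. by rewrite map_inj_uniq ?enum_uniq //; exact: perm_inj. Qed.

Lemma uniq_image_permP (ks : seq 'I_n) : uniq ks -> size ks = n ->
  exists s, forall s', (image s' == ks) = (s' == s).
Proof.
move=> uks sks; pose t : n.-tuple 'I_n := Tuple (introT eqP sks).
have f_inj : injective (tnth t) by exact/tuple_uniqP.
have <- : image (perm f_inj) = ks.
  by rewrite /image (eq_map (permE f_inj)) map_tnth_enum.
exists (perm f_inj) => s'; apply/eqP/eqP => [/eq_in_map ss'|-> //].
by apply/permP => i; apply: ss'; rewrite mem_enum.
Qed.

(** The induction fixes the values of the permutation one by one: [ks] lists those already chosen,
    and the size equation leaves one function in [ys] for each remaining position. *)
Lemma sum_perm_prefix (ys : seq ('I_n -> R)) (ks : seq 'I_n) :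
  uniq ks -> (size ks + size ys)%N = n ->
  \sum_(s : 'S_n | prefix ks (image s))
     \prod_(p <- zip ys (drop (size ks) (image s))) p.1 p.2
  = inj_sum [set k in ks] ys.
Proof.
elim: ys ks => [|y ys IH] ks uks /= sz.
  rewrite addn0 in sz; have [s0 s0P] := uniq_image_permP uks sz.
  rewrite (big_pred1 s0) => [|s].
    by rewrite drop_oversize ?size_image_perm ?sz// big_nil.
  by rewrite /= -s0P prefixE sz take_oversize ?size_image_perm.
have sk : (size ks < n)%N by rewrite -[X in (_ < X)%N]sz addnS ltnS leq_addr.
pose k0 : 'I_n := Ordinal sk.
have imk s : nth k0 (image s) (size ks) = s k0.
  rewrite (nth_map k0) ?size_enum_ord//; congr (s _); apply: val_inj.
  by rewrite /= nth_enum_ord.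
rewrite (partition_big (fun s : 'S_n => s k0) (fun i => i \notin [set k in ks])) /=.
  apply: eq_bigr => i; rewrite inE => iks.
  rewrite (_ : _ |: _ = [set k in rcons ks i]); last first.
    by apply/setP => j; rewrite !inE mem_rcons inE.
  rewrite -IH ?rcons_uniq ?iks ?size_rcons ?addSnnS// mulr_sumr.
  apply: eq_big => [s|s /andP[_ /eqP si]].
    rewrite !prefixE size_rcons (take_nth k0) ?size_image_perm// imk.
    by rewrite eqseq_rcons.
  by rewrite (drop_nth k0) ?size_image_perm// imk /= big_cons si.
move=> s; rewrite prefixE inE => /eqP kss; rewrite -kss -imk.
have := uniq_image_perm s; rewrite -{1}(cat_take_drop (size ks) (image s)).
rewrite cat_uniq => /and3P[_ /hasPn + _]; apply.
by rewrite (drop_nth k0) ?size_image_perm// mem_head.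
Qed.

Lemma sum_perm_prod (y : 'I_n -> 'I_n -> R) :
  \sum_(s : 'S_n) \prod_i y i (s i) = inj_sum finset.set0 [seq y i | i <- enum 'I_n].
Proof.
transitivity (inj_sum [set k in [::]] [seq y i | i <- enum 'I_n]); last first.
  by congr inj_sum; apply/setP => j; rewrite !inE.
rewrite -sum_perm_prefix //; last by rewrite size_map size_enum_ord.
apply: eq_big => [s|s _]; first by rewrite prefix0s.
by rewrite drop0 /image zip_map big_map big_enum.
Qed.

End PermutationSums.

(** * Multisymmetric polynomials *)

Section Monomials.
Context {R : realType} {d : nat}.
Local Notation expo := {ffun 'I_d -> nat}.

Definition mono (s : expo) (r : 'rV[R]_d) : R := \prod_j r 0 j ^+ s j.

Definition mdegree (s : expo) : nat := (\sum_j s j)%N.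

Definition addexpo (s t : expo) : expo := [ffun j => (s j + t j)%N].

Lemma mono_add s t r : mono (addexpo s t) r = mono s r * mono t r.
Proof.
by rewrite -big_split; apply: eq_bigr => j _; rewrite ffunE exprD.
Qed.

Lemma mdegree_add s t : mdegree (addexpo s t) = (mdegree s + mdegree t)%N.
Proof. by rewrite -big_split; apply: eq_bigr => j _; rewrite ffunE. Qed.

Definition expo0 : expo := [ffun=> 0%N].

Lemma mono0 r : mono expo0 r = 1.
Proof. by rewrite /mono big1 // => j _; rewrite ffunE. Qed.

Lemma addexpo0 s : addexpo s expo0 = s.
Proof. by apply/ffunP => j; rewrite !ffunE addn0. Qed.

Lemma addexpoA : associative addexpo.
Proof. by move=> s t u; apply/ffunP => j; rewrite !ffunE addnA. Qed.

Lemma addexpoC : commutative addexpo.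
Proof. by move=> s t; apply/ffunP => j; rewrite !ffunE addnC. Qed.

Definition sumexpo : seq expo -> expo := foldr addexpo expo0.

Lemma sumexpo_cat ss ts : sumexpo (ss ++ ts) = addexpo (sumexpo ss) (sumexpo ts).
Proof.
elim: ss => [|s ss IH] /=; first by rewrite addexpoC addexpo0.
by rewrite IH addexpoA.
Qed.

Definition unitexpo (j : 'I_d) : expo := [ffun i => (i == j) : nat].

Lemma mono_unit j r : mono (unitexpo j) r = r 0 j.
Proof.
rewrite /mono (bigD1 j) //= ffunE eqxx expr1 big1 ?mulr1// => i /negPf ij.
by rewrite ffunE ij.
Qed.

Lemma mdegree_unit j : mdegree (unitexpo j) = 1%N.
Proof.
rewrite /mdegree (bigD1 j) //= ffunE eqxx big1 ?addn0// => i /negPf ij.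
by rewrite ffunE ij.
Qed.

(** With [m = n], a monomial of degree above [n] becomes a product of [n.+1] nonconstant monomials,
    one factor more than there are distinct indices. *)
Lemma expo_split m s : (m < mdegree s)%N ->
  exists ss, [/\ size ss = m.+1, all (fun t => 0 < mdegree t)%N ss & sumexpo ss = s].
Proof.
elim: m s => [|m IH] s ms.
  by exists [:: s]; rewrite /= ms addexpo0.
have [j sj] : exists j, (0 < s j)%N.
  apply/existsP; apply: contraTT ms => /existsPn s0.
  rewrite /mdegree big1 // => j _; apply/eqP; rewrite -leqn0 leqNgt; exact: s0.
pose t : expo := [ffun i => (s i - (i == j))%N].
have st : s = addexpo (unitexpo j) t.
  apply/ffunP => i; rewrite !ffunE; case: eqP => [->|_]; last by rewrite subn0.
  by rewrite subnKC.
have [|ss [sz pos e]] := IH t.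
  by move: ms; rewrite st mdegree_add mdegree_unit add1n ltnS.
exists (unitexpo j :: ss); split => /=; first by rewrite sz.
  by rewrite mdegree_unit.
by rewrite e -st.
Qed.

End Monomials.

Section PowerSumAlgebra.
Context {R : realType} {n d M : nat} (phi : 'rV[R]_d -> 'rV[R]_M).
Implicit Types (g h : 'M[R]_(n, d) -> R) (y : 'rV[R]_d -> R).
Local Notation expo := {ffun 'I_d -> nat}.

Definition poly_in_sums g := exists rho : mpoly.mpoly M R,
  forall x, g x = poly_eval rho (\sum_(i < n) phi (row i x)).

Lemma eq_pis g h : g =1 h -> poly_in_sums g -> poly_in_sums h.
Proof. by move=> gh [rho r]; exists rho => x; rewrite -gh. Qed.

Lemma pis_cst c : poly_in_sums (fun=> c).
Proof. by exists (mpoly.mpolyC M c) => x; rewrite /poly_eval mpoly.mevalC. Qed.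

Lemma pisD g h : poly_in_sums g -> poly_in_sums h ->
  poly_in_sums (fun x => g x + h x).
Proof.
by move=> [r1 e1] [r2 e2]; exists (r1 + r2) => x; rewrite e1 e2 /poly_eval mpoly.mevalD.
Qed.

Lemma pisM g h : poly_in_sums g -> poly_in_sums h ->
  poly_in_sums (fun x => g x * h x).
Proof.
by move=> [r1 e1] [r2 e2]; exists (r1 * r2) => x; rewrite e1 e2 /poly_eval mpoly.mevalM.
Qed.

Lemma pisZ c g : poly_in_sums g -> poly_in_sums (fun x => c * g x).
Proof. by move=> ?; apply: pisM => //; exact: pis_cst. Qed.

Lemma pisB g h : poly_in_sums g -> poly_in_sums h ->
  poly_in_sums (fun x => g x - h x).
Proof.
move=> gp /(pisZ (-1)) hp; apply: eq_pis (pisD gp hp) => x /=.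
by rewrite mulN1r.
Qed.

Lemma pis_sum (I : eqType) (s : seq I) (F : I -> 'M[R]_(n, d) -> R) :
  {in s, forall i, poly_in_sums (F i)} ->
  poly_in_sums (fun x => \sum_(i <- s) F i x).
Proof.
elim: s => [_|i s IH H].
  by apply: eq_pis (pis_cst 0) => x; rewrite big_nil.
have Hi := H i (mem_head _ _).
have Hs := IH (fun j js => H j (mem_behead (s := i :: s) js)).
by apply: eq_pis (pisD Hi Hs) => x; rewrite big_cons.
Qed.

Definition psum y (x : 'M[R]_(n, d)) : R := \sum_i y (row i x).

Hypothesis low_degree : forall s, (mdegree s <= n)%N -> poly_in_sums (psum (mono s)).

Let ev (x : 'M[R]_(n, d)) (s : expo) := fun i => mono s (row i x).

Let evD x s t : ev x (addexpo s t) = mulf (ev x s) (ev x t).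
Proof. by apply/funext => i; exact: mono_add. Qed.

(* Newton's identity modulo power sums of lower degree: the injective sum of more
   than n factors vanishes, which leaves the power sum of their product. *)
Lemma inj_sum_newton ss : ss != [::] -> all (fun s => 0 < mdegree s)%N ss ->
  (forall s, (mdegree s < mdegree (sumexpo ss))%N -> poly_in_sums (psum (mono s))) ->
  poly_in_sums (fun x => inj_sum finset.set0 (map (ev x) ss)
    - ((-1) ^+ (size ss).-1 * ((size ss).-1)`!%:R) * psum (mono (sumexpo ss)) x).
Proof.
move: {2}(size ss).-1 (erefl (size ss).-1) => m.
elim: m ss => [|m IH] [|z ys] //= sz _ /andP[z0 ys0] low.
  move/size0nil: sz low => ->; rewrite /= addexpo0 => _; apply: eq_pis (pis_cst 0) => x.
  rewrite fact0 mulr1 mul1r; apply/esym/eqP; rewrite subr_eq0; apply/eqP.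
  by apply: eq_big => i; rewrite ?inE// mulr1.
have ysN : ys != [::] by case: ys sz {ys0 low}.
have degE : mdegree (addexpo z (sumexpo ys)) = (mdegree z + mdegree (sumexpo ys))%N.
  exact: mdegree_add.
have ysP : (0 < mdegree (sumexpo ys))%N.
  case: ys ysN ys0 {sz low degE} => //= y ys _ /andP[y0 _].
  by rewrite mdegree_add addn_gt0 y0.
have zA : poly_in_sums (psum (mono z)) by apply: low; rewrite degE -{1}[mdegree z]addn0 ltn_add2l.
have ylt : (mdegree (sumexpo ys) < mdegree (addexpo z (sumexpo ys)))%N.
  by rewrite degE -{1}[X in (X < _)%N]add0n ltn_add2r.
have ysA : poly_in_sums (fun x => inj_sum finset.set0 (map (ev x) ys)).
  have := IH ys _ ysN ys0 (fun s hs => low s (ltn_trans hs ylt)).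
  rewrite sz => /(_ erefl) Hd.
  by apply: eq_pis (pisD Hd (pisZ ((-1) ^+ m * m`!%:R) (low _ ylt))) => x /=; rewrite subrK.
have mA : {in merges addexpo z ys, forall w,
  poly_in_sums (fun x => inj_sum finset.set0 (map (ev x) w)
    - ((-1) ^+ m * m`!%:R) * psum (mono (addexpo z (sumexpo ys))) x)}.
  apply: merges_ind => ys1 y ys2 e.
  have szw : (size (ys1 ++ addexpo y z :: ys2)).-1 = m.
    by rewrite size_cat /= addnS /=; move: sz; rewrite e size_cat /= addnS => -[].
  have sw : sumexpo (ys1 ++ addexpo y z :: ys2) = addexpo z (sumexpo ys).
    rewrite e !sumexpo_cat /= -addexpoA addexpoC [RHS]addexpoC !addexpoA.
    by rewrite -!addexpoA addexpoC; apply/ffunP => j; rewrite !ffunE; lia.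
  have wN : ys1 ++ addexpo y z :: ys2 != [::] by case: (ys1).
  have w0 : all (fun s => 0 < mdegree s)%N (ys1 ++ addexpo y z :: ys2).
    by move: ys0; rewrite e !all_cat /= mdegree_add addn_gt0 => /and3P[-> -> ->].
  by have := IH _ szw wN w0; rewrite szw sw; apply.
have := pisB (pisM zA ysA) (pis_sum mA).
apply: eq_pis => x; rewrite -/(inj_sum finset.set0 (ev x z :: map (ev x) ys)) inj_sum_cons.
(* There are [m.+1] merges, each with the coefficient [(-1) ^+ m * m!]; the minus sign of
   [inj_sum_cons] makes the total [(-1) ^+ m.+1 * m.+1!]. *)
rewrite sumrB big_const_seq count_predT size_merges iter_addr_0 sz.
rewrite -(map_merges _ _ (evD x)) big_map.
have -> : \sum_(i | i \notin finset.set0) ev x z i = psum (mono z) x.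
  by apply: eq_bigl => i; rewrite inE.
rewrite factS natrM exprS -mulr_natl; ring.
Qed.

Lemma pis_psum_mono s : poly_in_sums (psum (mono s)).
Proof.
have [m] := ubnP (mdegree s); elim: m s => // m IH s sm.
have [/low_degree //|ns] := leqP (mdegree s) n.
have [ss [szss pos e]] := expo_split ns.
have ssN : ss != [::] by case: (ss) szss.
have low t : (mdegree t < mdegree (sumexpo ss))%N -> poly_in_sums (psum (mono t)).
  by rewrite e => ts; apply: IH; apply: leq_trans ts _; rewrite -ltnS.
have := inj_sum_newton ssN pos low; rewrite e szss /=.
(* Characteristic zero enters here: the power sum is recovered by dividing by this coefficient. *)
have cN : (-1) ^+ n * n`!%:R != 0 :> R.
  by rewrite mulf_neq0 ?signr_eq0 ?pnatr_eq0 -?lt0n ?fact_gt0.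
move=> /(pisZ (- ((-1) ^+ n * n`!%:R)^-1)); apply: eq_pis => x.
rewrite inj_sum_oversize ?size_map ?szss ?cards0 ?add0n// sub0r.
by rewrite mulNr mulrN opprK mulKf.
Qed.

Definition sep_poly (q : 'I_d -> {poly R}) (r : 'rV[R]_d) := \prod_j (q j).[r 0 j].

(** Quantifying over a monomial factor makes the property stable under multiplication by a
    coordinate, so that Horner's scheme can multiply in the polynomials [q j] one after another. *)
Let absorbing y := forall s, poly_in_sums (psum (fun r => mono s r * y r)).

Let absorbing_coord y j : absorbing y -> absorbing (fun r => y r * r 0 j).
Proof.
move=> yP s; apply: eq_pis (yP (addexpo s (unitexpo j))) => x.
by apply: eq_bigr => i _; rewrite mono_add mono_unit mulrAC mulrA.
Qed.

Let absorbing_poly y j (p : {poly R}) : absorbing y ->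
  absorbing (fun r => y r * p.[r 0 j]).
Proof.
elim/poly_ind: p y => [|p c IH] y yP s.
  apply: eq_pis (pis_cst 0) => x; rewrite /psum big1 // => i _.
  by rewrite horner0 !mulr0.
apply: eq_pis (pisD (IH _ (absorbing_coord j yP) s) (pisZ c (yP s))) => x.
rewrite mulr_sumr -big_split; apply: eq_bigr => i _ /=.
by rewrite hornerMXaddC; ring.
Qed.

Lemma pis_psum_sep q : poly_in_sums (psum (sep_poly q)).
Proof.
have qP js : absorbing (fun r => \prod_(j <- js) (q j).[r 0 j]).
  elim: js => [|j js IH] s.
    apply: eq_pis (pis_psum_mono s) => x; apply: eq_bigr => i _.
    by rewrite big_nil mulr1.
  apply: eq_pis (absorbing_poly j (q j) IH s) => x; apply: eq_bigr => i _.
  by rewrite big_cons [X in _ * X]mulrC.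
apply: eq_pis (qP (index_enum _) expo0) => x; apply: eq_bigr => i _.
by rewrite mono0 mul1r.
Qed.

Definition mul_sep (p q : 'I_d -> {poly R}) := fun j => p j * q j.

Let evp (x : 'M[R]_(n, d)) q := fun i => sep_poly q (row i x).

Let evpM x p q : evp x (mul_sep p q) = mulf (evp x p) (evp x q).
Proof.
apply/funext => i; rewrite /mulf /evp /sep_poly -big_split.
by apply: eq_bigr => j _; rewrite hornerM.
Qed.

(** With all power sums available, [inj_sum_cons] is a recursion on the number of factors: a merge
    shortens the list, and separable polynomials are closed under products. *)
Lemma pis_inj_sum_sep qs :
  poly_in_sums (fun x => inj_sum finset.set0 (map (evp x) qs)).
Proof.
have [m] := ubnP (size qs); elim: m qs => // m IH [|q qs] sm.
  exact: pis_cst.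
have mA : {in merges mul_sep q qs, forall w,
    poly_in_sums (fun x => inj_sum finset.set0 (map (evp x) w))}.
  by apply: merges_ind => u p v e; apply: IH; move: sm; rewrite e /= !size_cat ltnS.
apply: eq_pis (pisB (pisM (pis_psum_sep q) (IH qs sm)) (pis_sum mA)) => x.
rewrite map_cons inj_sum_cons -(map_merges _ _ (evpM x)) big_map.
by congr (_ * _ - _); apply: eq_bigl => i; rewrite inE.
Qed.

Lemma pis_sum_perm_sep (q : 'I_n -> 'I_d -> {poly R}) :
  poly_in_sums (fun x => \sum_(s : 'S_n) \prod_i sep_poly (q i) (row (s i) x)).
Proof.
apply: eq_pis (pis_inj_sum_sep (map q (enum 'I_n))) => x.
by rewrite (sum_perm_prod (fun i => evp x (q i))) -map_comp.
Qed.

End PowerSumAlgebra.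

Lemma exists_monomial_map (R : realType) (n d : nat) :
  exists phi : 'rV[R]_d -> 'rV[R]_('C(n + d, d)), monomial_map n phi.
Proof.
(* A total degree at most [n] bounds every exponent by [n], so the exponents sit in a finite type,
   where they can be counted and enumerated. *)
pose B := [set t : d.-tuple 'I_n.+1 | (\sum_(i <- t) i <= n)%N]%SET.
have cB : #|B| = 'C(n + d, d) by rewrite card_partial_ord_partitions addnC.
rewrite -cB.
pose s (k : 'I_#|B|) : {ffun 'I_d -> nat} := [ffun i => tnth (enum_val k) i : nat].
exists (fun x => \row_j \prod_i x 0 i ^+ s j i), s; split.
- move=> j k /ffunP jk; apply: enum_val_inj; apply: eq_from_tnth => i.
  by have := jk i; rewrite !ffunE => /val_inj.
- move=> a; split => [an|[j <-]].
    have ai i : (a i < n.+1)%N by rewrite ltnS (leq_trans _ an) // (bigD1 i) //= leq_addr.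
    pose t := [tuple Ordinal (ai i) | i < d].
    have tB : t \in B.
      by rewrite inE big_tuple; under eq_bigr => i _ do rewrite tnth_mktuple.
    exists (enum_rank_in tB t); apply/ffunP => i.
    by rewrite ffunE enum_rankK_in // tnth_mktuple.
  have := enum_valP j; rewrite inE big_tuple => jn.
  by under eq_bigr => i _ do rewrite ffunE.
- by move=> x j; rewrite mxE.
Qed.

Lemma monomial_map_low_degree (R : realType) (n d M : nat)
    (phi : 'rV[R]_d -> 'rV[R]_M) s : monomial_map n phi ->
  (mdegree s <= n)%N -> @poly_in_sums R n d M phi (psum (mono s)).
Proof.
move=> [e [_ eP phiE]] /eP[j <-].
exists (mpoly.mpolyX R (mpoly.mnm1 j)) => x.
rewrite /poly_eval mpoly.mevalXU summxE.
by apply: eq_bigr => i _; rewrite phiE.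
Qed.

(** * Bernstein polynomials *)

Lemma is_derive_congr (R : numFieldType) (V W : normedModType R) (f g : V -> W)
    (df dg : W) x v :
  is_derive x v f df -> f =1 g -> df = dg -> is_derive x v g dg.
Proof. by move=> + /funext<- <-. Qed.

Section Bern.
Context {R : realType}.
Implicit Types (g h : nat -> R) (t : R).

(* De Casteljau's recursion for the Bernstein polynomial of degree m with the
   values g 0, ..., g m at the nodes. *)
Fixpoint bern m g t : R :=
  if m is m'.+1 then (1 - t) * bern m' g t + t * bern m' (g \o succn) t else g 0%N.

Lemma eq_bern m g h t : g =1 h -> bern m g t = bern m h t.
Proof. by move=> gh; congr bern; apply/funext. Qed.

Lemma bernD m g h t : bern m (fun l => g l + h l) t = bern m g t + bern m h t.
Proof.
elim: m g h => [|m IH] g h //=.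
by rewrite (IH g h) (IH (g \o succn) (h \o succn)); ring.
Qed.

Lemma bernZ m c g t : bern m (fun l => c * g l) t = c * bern m g t.
Proof.
elim: m g => [|m IH] g //=.
by rewrite (IH g) (IH (g \o succn)); ring.
Qed.

Lemma bernB m g h t : bern m (fun l => g l - h l) t = bern m g t - bern m h t.
Proof.
elim: m g h => [|m IH] g h //=.
by rewrite (IH g h) (IH (g \o succn) (h \o succn)); ring.
Qed.

Lemma bern_cst m c t : bern m (fun=> c) t = c.
Proof.
elim: m => [|m IH] //=.
by rewrite [bern m (_ \o _) t]IH; ring.
Qed.

Lemma bern_le m g h t : 0 <= t <= 1 -> (forall l, (l <= m)%N -> g l <= h l) ->
  bern m g t <= bern m h t.
Proof.
move=> /andP[t0 t1]; elim: m g h => [|m IH] g h gh /=; first exact: gh.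
rewrite lerD // ler_wpM2l ?subr_ge0// IH // => l lm; apply: gh => //.
exact: leqW.
Qed.

Lemma bern_norm m g h t : 0 <= t <= 1 -> (forall l, (l <= m)%N -> `|g l| <= h l) ->
  `|bern m g t| <= bern m h t.
Proof.
move=> t01 gh; rewrite ler_norml -[- _]mulN1r -bernZ; apply/andP; split.
  by apply: bern_le => // l /gh; rewrite ler_norml mulN1r => /andP[].
by apply: bern_le => // l /gh; rewrite ler_norml => /andP[].
Qed.

(** This is the second moment of the binomial distribution about [c], variance plus squared bias.
    The free centre absorbs the index shift of the recursion, and later it takes the value
    [M%:R * t] for a degree below [M]. *)
Lemma bern_square m c t :
  bern m (fun l => (l%:R - c) ^+ 2) t = m%:R * t * (1 - t) + (m%:R * t - c) ^+ 2.
Proof.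
elim: m c => [|m IH] c /=; first by ring.
rewrite (IH c) (@eq_bern _ _ (fun l => (l%:R - (c - 1)) ^+ 2)); last first.
  by move=> l /=; rewrite -natr1; ring.
by rewrite IH -natr1; ring.
Qed.

Lemma bern_exchange m m' (g : nat -> nat -> R) t t' :
  bern m (fun l => bern m' (g l) t') t = bern m' (fun l' => bern m (g^~ l') t) t'.
Proof.
elim: m g => [|m IH] g //=.
rewrite (IH g) (IH (g \o succn)) bernD !bernZ.
by [].
Qed.

Context {V : normedModType R}.
Implicit Types (G : nat -> V -> R) (u : V -> R) (x v : V).

Lemma is_derive_bern_nodes m G (dG : nat -> R) u x v :
  (forall l, is_derive x v (G l) (dG l)) -> is_derive x v u 0 ->
  is_derive x v (fun y => bern m (G^~ y) (u y)) (bern m dG (u x)).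
Proof.
move=> + Hu; elim: m G dG => [|m IH] G dG HG /=; first exact: HG.
have H1 := IH _ _ HG; have H2 := IH (G \o succn) (dG \o succn) (fun l => HG l.+1).
have Hc := is_derive_cst (1 : R) x v.
have H := is_deriveD (is_deriveM (is_deriveB Hc Hu) H1) (is_deriveM Hu H2).
apply: is_derive_congr H _ _ => //.
by rewrite /GRing.scale /= /cst !fctE; ring.
Qed.

Lemma is_derive_bern m g u (du : R) x v : is_derive x v u du ->
  is_derive x v (fun y => bern m.+1 g (u y))
    (m.+1%:R * du * bern m (fun l => g l.+1 - g l) (u x)).
Proof.
move=> Hu; have Hc := is_derive_cst (1 : R) x v; elim: m g => [|m IH] g.
  have H0 := is_derive_cst (g 0%N) x v; have H1 := is_derive_cst (g 1%N) x v.
  have H := is_deriveD (is_deriveM (is_deriveB Hc Hu) H0) (is_deriveM Hu H1).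
  apply: is_derive_congr H _ _ => //.
  by rewrite /GRing.scale /= /cst !fctE; ring.
have H1 := IH g; have H2 := IH (g \o succn).
have H := is_deriveD (is_deriveM (is_deriveB Hc Hu) H1) (is_deriveM Hu H2).
apply: is_derive_congr H _ _ => //.
rewrite /GRing.scale /= /cst !fctE -(natr1 m.+1) !bernB /=; ring.
Qed.

Lemma continuous_bern m G u : (forall l, continuous (G l)) -> continuous u ->
  continuous (fun y => bern m (G^~ y) (u y)).
Proof.
move=> + cu; elim: m G => [|m IH] G cG; first exact: cG.
have cG' l : continuous ((G \o succn) l) by exact: cG.
move=> x; apply: cvgD; apply: cvgM.
- by apply: cvgB; [exact: cvg_cst|exact: cu].
- exact: IH.
- exact: cu.
- exact: (IH _ cG').
Qed.

End Bern.

Section ContinuityHelpers.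
Context {R : realType} {V : normedModType R}.
Implicit Types (u w : V -> R) (v x : V).

Lemma continuous_at_affine u v (s : R) x : {for x, continuous u} ->
  {for x, continuous (fun y => (s - u y) *: v + y)}.
Proof.
move=> cu; apply: cvgD; last exact: cvg_id.
by apply: cvgZr_tmp; apply: cvgB; [exact: cvg_cst|exact: cu].
Qed.

Lemma continuous_at_scale_shift u (a b : R) x : {for x, continuous u} ->
  {for x, continuous (fun y => (u y + a) / b)}.
Proof.
by move=> cu; apply: cvgMr_tmp; apply: cvgD; [exact: cu|exact: cvg_cst].
Qed.

Lemma continuous_difference_quotient (H : V -> R) v (h : R) :
  continuous H -> continuous (fun y => (H (v + y) - H y) / h).
Proof.
move=> cH x; apply: cvgMr_tmp; apply: cvgB; last exact: cH.
apply: (@continuous_comp _ _ _ (fun y => v + y) H x); last exact: cH.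
by apply: cvgD; [exact: cvg_cst|exact: cvg_id].
Qed.

End ContinuityHelpers.

Section Coordinates.
Context {R : realType} {n d : nat}.
Local Notation I := ('I_n * 'I_d)%type.
Local Notation Mat := 'M[R]_(n, d).
Implicit Types (c : I) (x y : Mat) (H : Mat -> R) (cs : seq I).

Definition dir c : Mat := delta_mx c.1 c.2.

Definition coord c x : R := x c.1 c.2.

Lemma coord_dir c c' : coord c (dir c') = (c == c')%:R.
Proof. by rewrite /coord mxE -pair_eqE. Qed.

Lemma coordE c (a : R) x y : coord c (a *: x + y) = a * coord c x + coord c y.
Proof. by rewrite /coord !mxE. Qed.

Lemma coordDZ c c' (a : R) x : c != c' -> coord c (a *: dir c' + x) = coord c x.
Proof.
by move=> /negPf cc'; rewrite coordE coord_dir cc' mulr0 add0r.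
Qed.

Lemma coordDZ_same c (a : R) x : coord c (a *: dir c + x) = a + coord c x.
Proof. by rewrite coordE coord_dir eqxx mulr1. Qed.

Definition upd c x (s : R) : Mat := (s - coord c x) *: dir c + x.

Lemma coord_upd c c' x s : coord c (upd c' x s) = if c == c' then s else coord c x.
Proof.
rewrite /upd; case: eqVneq => [->|cc']; last by rewrite coordDZ.
by rewrite coordDZ_same subrK.
Qed.

Lemma updDZ c c' (a : R) x s : c' != c ->
  upd c' (a *: dir c + x) s = a *: dir c + upd c' x s.
Proof. by move=> cc'; rewrite /upd coordDZ// addrCA. Qed.

Lemma updDZ_same c (a : R) x s : upd c (a *: dir c + x) s = upd c x s.
Proof. by rewrite /upd coordDZ_same addrA -scalerDl; congr (_ *: _ + _); ring. Qed.

Lemma upd_move c (a : R) x s : upd c x (a + s) = a *: dir c + upd c x s.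
Proof. by rewrite /upd addrA -scalerDl addrA. Qed.

Lemma continuous_coord c : continuous (coord c).
Proof. exact: coord_continuous. Qed.

Lemma coordP x y : (forall c, coord c x = coord c y) -> x = y.
Proof. by move=> xy; apply/matrixP => i j; exact: (xy (i, j)). Qed.

Lemma upd_upd c x s s' : upd c (upd c x s) s' = upd c x s'.
Proof. by apply: coordP => c'; rewrite !coord_upd; case: eqP. Qed.

Lemma updC c c' x s s' : c != c' -> upd c (upd c' x s') s = upd c' (upd c x s) s'.
Proof.
move=> cc'; apply: coordP => b; rewrite !coord_upd.
by case: (eqVneq b c) => [->|//]; rewrite (negPf cc').
Qed.

Definition perm_coord (s : 'S_n) c : I := (s c.1, c.2).

Lemma perm_coord_inj s : injective (perm_coord s).
Proof. by move=> [i j] [i' j'] [/perm_inj -> ->]. Qed.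

Lemma coord_row_perm s c x : coord c (row_perm s x) = coord (perm_coord s c) x.
Proof. by rewrite /coord mxE. Qed.

Lemma upd_row_perm s c x a :
  upd c (row_perm s x) a = row_perm s (upd (perm_coord s c) x a).
Proof.
apply: coordP => b; rewrite coord_row_perm !coord_upd coord_row_perm.
by rewrite (inj_eq (@perm_coord_inj s)).
Qed.

(** Freezing the coordinates outside [cs] at [y] supports the induction on the list of coordinates
    when a Bernstein polynomial is expanded into separable ones. *)
Definition mix cs x y : Mat := foldr (fun c z => upd c z (coord c x)) y cs.

Lemma coord_mix c cs x y :
  coord c (mix cs x y) = if c \in cs then coord c x else coord c y.
Proof.
elim: cs => //= c' cs IH; rewrite coord_upd IH inE.
by case: eqP => [->|].
Qed.

Lemma upd_mix c cs x y a : c \notin cs -> upd c (mix cs x y) a = mix cs x (upd c y a).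
Proof.
move=> ccs; apply: coordP => b; rewrite coord_upd !coord_mix coord_upd.
by case: (eqVneq b c) => [->|//]; rewrite (negPf ccs).
Qed.

Lemma is_derive_coord c x v : is_derive x v (coord c) (coord c v).
Proof.
have D h : h != 0 ->
    h^-1 *: ((coord c \o shift x) (h *: v) - coord c x) = coord c v.
  by move=> h0; rewrite /= coordE addrK [_ *: _]mulKf.
have nD : \forall h \near 0^',
    h^-1 *: ((coord c \o shift x) (h *: v) - coord c x) = coord c v.
  by near=> h; apply: D; near: h; exact: nbhs_dnbhs_neq.
split; first by apply: is_cvg_near_cst; exact: nD.
by apply: lim_near_cst.
Unshelve. all: by end_near. Qed.

Lemma continuous_upd c s : continuous (fun x => upd c x s).
Proof.
by move=> x; apply: continuous_at_affine; exact: continuous_coord.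
Qed.

(* Translations commute with [upd] in another coordinate, so both sides are
   limits of the same difference quotients. *)
Lemma is_derive_upd c c' H x s a : c' != c ->
  is_derive (upd c' x s) (dir c) H a -> is_derive x (dir c) (fun y => H (upd c' y s)) a.
Proof.
move=> cc'; have E : (fun h => h^-1 *: ((H \o shift (upd c' x s)) (h *: dir c) - H (upd c' x s)))
   = (fun h => h^-1 *: (((fun y => H (upd c' y s)) \o shift x) (h *: dir c) - H (upd c' x s))).
  by apply/funext => h; rewrite /= updDZ.
by move=> [dH Ha]; split; [move: dH; rewrite /derivable E|rewrite -Ha /derive E].
Qed.

Lemma is_derive_line H x v (t a : R) : is_derive (t *: v + x) v H a ->
  is_derive t 1 (fun s => H (s *: v + x)) a.
Proof.
have E : (fun h => h^-1 *: ((H \o shift (t *: v + x)) (h *: v) - H (t *: v + x)))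
   = (fun h : R => h^-1 *: (((fun s => H (s *: v + x)) \o shift t) (h *: 1) - H (t *: v + x))).
  by apply/funext => h; rewrite /= scalerDl addrA [_ *: 1]mulr1.
by move=> [dH Ha]; split; [move: dH; rewrite /derivable E|rewrite -Ha /derive E].
Qed.

Lemma mean_value_line H x v (h : R) : 0 <= h -> (forall y, derivable H y v) ->
  exists2 s, 0 <= s <= h & H (h *: v + x) - H x = h * 'D_v H (s *: v + x).
Proof.
move=> h0 dH; have dl (t : R) : is_derive t 1 (fun s => H (s *: v + x)) ('D_v H (t *: v + x)).
  by apply: is_derive_line; exact: derivableP.
have [|s sh e] := @MVT_segment R (fun s => H (s *: v + x)) _ _ _ h0 (fun t _ => dl t).
  apply: continuous_subspaceT => t.
  by apply: differentiable_continuous; apply/derivable1_diffP; exact: ex_derive.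
exists s; first by move: sh; rewrite in_itv.
by move: e; rewrite scale0r add0r subr0 mulrC.
Qed.

End Coordinates.

(** * Tensor product Bernstein operators and their symmetry *)

Section BernsteinOperators.
Context {R : realType} {n d : nat} (L : R) (M : nat).
Hypotheses (L0 : 0 < L) (M0 : (0 < M)%N).
Local Notation I := ('I_n * 'I_d)%type.
Local Notation Mat := 'M[R]_(n, d).
Implicit Types (c : I) (x y : Mat) (H : Mat -> R) (cs : seq I) (m : I -> nat).

Definition mesh : R := 2 * L / M%:R.

Definition node (l : nat) : R := - L + l%:R * mesh.

Definition tau c x : R := (coord c x + L) / (2 * L).

(** The degree [k] is separate from the grid, which depends on [M]: a derivative lowers the degree
    and leaves the mesh unchanged. *)
Definition bern_coord k c H x := bern k (fun l => H (upd c x (node l))) (tau c x).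

Definition dquot c H x := (H (mesh *: dir c + x) - H x) / mesh.

Lemma mesh_gt0 : 0 < mesh.
Proof. by rewrite /mesh divr_gt0 ?mulr_gt0 ?ltr0n. Qed.

Lemma nodeS l : node l.+1 = mesh + node l.
Proof. by rewrite /node -natr1; ring. Qed.

Lemma is_derive_tau c x v : is_derive x v (tau c) (coord c v / (2 * L)).
Proof.
have H := is_deriveD (is_derive_coord c x v) (is_derive_cst L x v).
apply: is_derive_congr (is_deriveZ (2 * L)^-1 H) _ _ => [y|].
  by rewrite /tau [RHS]mulrC.
by rewrite addr0 [RHS]mulrC.
Qed.

Lemma tau_move c c' (a : R) x : c != c' -> tau c (a *: dir c' + x) = tau c x.
Proof. by move=> cc'; rewrite /tau coordDZ. Qed.

Lemma continuous_bern_coord k c H : continuous H -> continuous (bern_coord k c H).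
Proof.
move=> cH; apply: continuous_bern => [l x|x].
  by apply: (continuous_comp (@continuous_upd R n d c (node l) x)); exact: cH.
by apply: continuous_at_scale_shift; exact: continuous_coord.
Qed.

Lemma is_derive_bern_coord_other k c c' H x : c' != c -> (forall y, derivable H y (dir c)) ->
  is_derive x (dir c) (bern_coord k c' H) (bern_coord k c' (partial c H) x).
Proof.
move=> cc' dH; apply: is_derive_bern_nodes => [l|].
  by apply: is_derive_upd => //; exact: derivableP.
have := is_derive_tau c' x (dir c).
by rewrite coord_dir (negPf cc') mul0r.
Qed.

(** The inner derivative of [tau] is [1 / (2 * L)], and neighbouring node values differ by [mesh]
    times a difference quotient; together these constants give [1 / M]. *)
Lemma is_derive_bern_coord k c H x :
  is_derive x (dir c) (bern_coord k.+1 c H) (k.+1%:R / M%:R * bern_coord k c (dquot c H) x).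
Proof.
(* Moving along [dir c] does not affect the node values, because [upd c] overwrites that coordinate;
   they can be frozen at [x]. *)
pose B y := bern k.+1 (fun l => H (upd c x (node l))) (tau c y).
have E : (fun h => h^-1 *: ((bern_coord k.+1 c H \o shift x) (h *: dir c) - bern_coord k.+1 c H x))
  = (fun h => h^-1 *: ((B \o shift x) (h *: dir c) - B x)).
  apply/funext => h; rewrite /= /B /bern_coord; congr (_ *: (bern k.+1 _ _ - _)).
  by apply/funext => l; rewrite updDZ_same.
have [dB Ba] := is_derive_bern k (fun l => H (upd c x (node l)))
  (is_derive_tau c x (dir c)).
split; first by move: dB; rewrite /derivable E.
move: Ba; rewrite /derive E => ->.
rewrite coord_dir eqxx /bern_coord /dquot.
under [in RHS]eq_bern => l do rewrite -upd_move -nodeS mulrC.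
rewrite bernZ /mesh [nat_of_bool _]/= ?mulr1n; field.
by rewrite !pnatr_eq0 -!lt0n M0 gt_eqF.
Qed.

Lemma dquot_bern_coord k c c' H : c' != c ->
  dquot c (bern_coord k c' H) = bern_coord k c' (dquot c H).
Proof.
move=> cc'; apply/funext => x; rewrite /dquot /bern_coord tau_move// -bernB mulrC -bernZ.
by apply: eq_bern => l; rewrite updDZ// mulrC.
Qed.

Lemma dquotC c c' H : dquot c (dquot c' H) = dquot c' (dquot c H).
Proof. by apply/funext => x; rewrite /dquot addrCA; ring. Qed.

Lemma continuous_dquot c H : continuous H -> continuous (dquot c H).
Proof.
move=> cH; apply: continuous_difference_quotient => //.
Qed.

Lemma bern_coord_comm k k' c c' H : c != c' ->
  bern_coord k c (bern_coord k' c' H) = bern_coord k' c' (bern_coord k c H).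
Proof.
move=> cc'; apply/funext => x; rewrite /bern_coord.
rewrite (@eq_bern _ _ _
  (fun l => bern k' (fun l' => H (upd c (upd c' x (node l')) (node l))) (tau c' x))).
  rewrite bern_exchange; apply: eq_bern => l'.
  by congr bern; rewrite /tau coord_upd (negPf cc').
move=> l; rewrite /tau coord_upd eq_sym (negPf cc').
by apply: eq_bern => l'; rewrite updC 1?eq_sym.
Qed.

Lemma bern_coord_row_perm k c H (s : 'S_n) x :
  bern_coord k c H (row_perm s x) = bern_coord k (perm_coord s c) (fun y => H (row_perm s y)) x.
Proof.
rewrite /bern_coord /tau coord_row_perm; apply: eq_bern => l.
by rewrite upd_row_perm.
Qed.

Fixpoint bernstein m cs H := if cs is c :: cs' then bern_coord (m c) c (bernstein m cs' H) else H.

Lemma bernstein_cat m cs cs' H : bernstein m (cs ++ cs') H = bernstein m cs (bernstein m cs' H).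
Proof. by elim: cs => //= c cs ->. Qed.

Lemma continuous_bernstein m cs H : continuous H -> continuous (bernstein m cs H).
Proof. by move=> cH; elim: cs => //= c cs; exact: continuous_bern_coord. Qed.

Lemma eq_in_bernstein m m' cs H : {in cs, m =1 m'} -> bernstein m cs H = bernstein m' cs H.
Proof.
elim: cs => //= c cs IH mm'; rewrite mm' ?mem_head// IH // => c' c'cs.
by rewrite mm' // inE c'cs orbT.
Qed.

Lemma dquot_bernstein c m cs H : c \notin cs ->
  dquot c (bernstein m cs H) = bernstein m cs (dquot c H).
Proof.
elim: cs => //= c' cs IH; rewrite inE negb_or => /andP[cc' ccs].
by rewrite dquot_bern_coord 1?eq_sym// IH.
Qed.

Lemma is_derive_bernstein m c cs H x : uniq cs -> c \in cs -> (0 < m c)%N ->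
  is_derive x (dir c) (bernstein m cs H)
    ((m c)%:R / M%:R * bernstein (fun c' => (m c' - (c' == c))%N) cs (dquot c H) x).
Proof.
move=> + + mc; elim: cs x => //= c0 cs IH x /andP[c0cs ucs]; rewrite inE.
have [e _|cc0 /= ccs] := eqVneq c c0.
  subst c0; rewrite subn1; case: (m c) mc => // k _.
  apply: is_derive_congr (is_derive_bern_coord k c (bernstein m cs H) x) _ _ => //.
  rewrite dquot_bernstein //=; rewrite -(@eq_in_bernstein m)// => c' c'cs.
  by rewrite (_ : c' == c = false) ?subn0//; apply: contraNF c0cs => /eqP <-.
rewrite eq_sym in cc0; have D y := IH y ucs ccs.
have dD y : derivable (bernstein m cs H) y (dir c) by have [] := D y.
apply: is_derive_congr (is_derive_bern_coord_other (m c0) x cc0 dD) _ _ => //.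
rewrite subn0 -bernZ /=; congr bern; apply/funext => l.
by rewrite /partial derive_val.
Qed.

Lemma bern_coord_bernstein m c cs H :
  bern_coord (m c) c (bernstein m cs H) = bernstein m cs (bern_coord (m c) c H).
Proof.
elim: cs => //= c' cs <-; have [->//|cc'] := eqVneq c c'.
by rewrite bern_coord_comm.
Qed.

Lemma bernstein_perm m cs cs' H : perm_eq cs cs' -> bernstein m cs H = bernstein m cs' H.
Proof.
move=> pcs.
apply: (@catCA_perm_ind _ (fun s => bernstein m cs H = bernstein m s H) _ cs cs' pcs erefl).
move=> s1 s2 s3 ->; rewrite !bernstein_cat.
elim: s1 => //= c s1 ->.
by rewrite bern_coord_bernstein.
Qed.

Lemma bernstein_row_perm k cs H (s : 'S_n) x :
  bernstein (fun=> k) cs H (row_perm s x) =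
  bernstein (fun=> k) (map (perm_coord s) cs) (fun y => H (row_perm s y)) x.
Proof.
elim: cs x => //= c cs IH x; rewrite bern_coord_row_perm; congr (bern_coord k _ _ x).
by apply/funext => y; exact: IH.
Qed.

(** A row permutation of the argument becomes a permutation of the list of coordinates, whose order
    is immaterial since the one-coordinate operators commute. This relies on the same degree and
    grid in every coordinate. *)
Lemma bernstein_symmetric k H (s : 'S_n) x : (forall y, H (row_perm s y) = H y) ->
  bernstein (fun=> k) (enum {: I}) H (row_perm s x) = bernstein (fun=> k) (enum {: I}) H x.
Proof.
move=> Hs; rewrite bernstein_row_perm (_ : (fun y => _) = H); last exact/funext.
congr (_ x); apply: bernstein_perm; apply: uniq_perm; rewrite ?enum_uniq//.
  by rewrite map_inj_uniq ?enum_uniq//; exact: perm_coord_inj.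
move=> c; rewrite mem_enum; apply/mapP; exists (perm_coord s^-1 c); first by rewrite mem_enum.
by rewrite /perm_coord /= permKV; case: c.
Qed.

End BernsteinOperators.

(** * Compactness: uniform continuity, boundedness and boxes *)

Section UniformContinuity.
Context {R : realType} {V : normedModType R}.

(** Only [x] is confined to [K], because the mean value points attached to difference quotients may
    leave the box. *)
Lemma compact_uniformly_continuous (K : set V) (H : V -> R) (e : R) :
  compact K -> continuous H -> 0 < e ->
  exists2 r, 0 < r & forall x y, K x -> ball x r y -> `|H x - H y| <= e.
Proof.
move=> /compact_near_coveringP cK cH e0.
have e20 : 0 < e / 2 by rewrite divr_gt0.
have := cK R (0^'+ : set_system R) (fun r x => forall y, ball x r y -> `|H x - H y| <= e) _.
case=> [x Kx|r /= r0 Hr].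
  have /cvg_ballP /(_ _ e20) /nbhs_ballP[s /= s0 Hs] := cH x.
  exists (ball x (s / 2), [set r | 0 < r < s / 2]) => /=.
    split; first by apply: nbhsx_ballx; rewrite divr_gt0.
    near=> r; apply/andP; split; first by near: r; exact: nbhs_right_gt.
    by near: r; apply: nbhs_right_lt; rewrite divr_gt0.
  move=> [x' r] /= [xx' /andP[r0 rs]] y x'y.
  have /Hs h1 : ball x s x' by apply: le_ball xx'; rewrite ler_piMr ?invf_le1 ?ler1n// ltW.
  have /Hs h2 : ball x s y.
    by rewrite [s]splitr; apply: ball_triangle xx' _; apply: le_ball x'y; exact: ltW.
  rewrite (_ : H x' - H y = (H x - H y) - (H x - H x')); last by ring.
  rewrite [e]splitr (le_trans (ler_normB _ _))// lerD// ltW//.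
exists (r / 2); first by rewrite divr_gt0.
move=> x y Kx xy; apply: (Hr (r / 2)) => //=.
  by rewrite /ball_ /= sub0r normrN gtr0_norm ?divr_gt0// ltr_pdivrMr// ltr_pMr// ltr1n.
by rewrite divr_gt0.
Unshelve. all: by end_near. Qed.

Lemma compact_bounded_image (K : set V) (H : V -> R) :
  compact K -> continuous H -> exists C, forall x, K x -> `|H x| <= C.
Proof.
move=> cK cH.
have : compact (H @` K) by apply: continuous_compact => //; apply: continuous_subspaceT.
move=> /compact_bounded[C [_ HC]]; exists (C + 1) => x Kx.
by apply: (HC (C + 1)); [rewrite ltrDl|exists x].
Qed.

End UniformContinuity.

Section Box.
Context {R : realType} {n d : nat}.
Local Notation Mat := 'M[R]_(n, d).

Definition box (r : R) : set Mat := [set x | forall c, `|coord c x| <= r].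

Lemma continuous_vec_mx : continuous (vec_mx : 'rV[R]_(n * d) -> Mat).
Proof.
move=> u s /= /(nbhs_ballP (vec_mx u)) [e e0 es].
apply/nbhs_ballP; exists e => // v [_ uv]; apply: es; split => // i j.
by rewrite !mxE; exact: uv.
Qed.

Lemma compact_box r : compact (box r).
Proof.
rewrite (_ : box r = vec_mx @` [set v : 'rV[R]_(n * d) | forall i, `[- r, r]%classic (v ord0 i)]).
  apply: continuous_compact; first by apply: continuous_subspaceT; exact: continuous_vec_mx.
  apply: (@rV_compact _ _ (fun=> `[- r, r]%classic)) => _; exact: segment_compact.
apply/seteqP; split => [x xr|_ [v vr <-] c] /=.
  exists (mxvec x); last exact: mxvecK.
  move=> k; case/mxvec_indexP: k => i j; rewrite mxvecE.
  by have := xr (i, j); rewrite ler_norml /= in_itv.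
by have := vr (mxvec_index c.1 c.2); rewrite /coord mxE /= in_itv /= ler_norml.
Qed.

End Box.

Section LinearHelpers.
Context {R : realType} {V : normedModType R}.
Implicit Types (H : V -> R) (v x : V) (a : R).

Lemma continuous_scaled a H : continuous H -> continuous (fun x => a * H x).
Proof. by move=> cH x; apply: cvgMl_tmp; exact: cH. Qed.

Lemma is_derive_scaled a H x v dH : is_derive x v H dH ->
  is_derive x v (fun y => a * H y) (a * dH).
Proof. by move=> dHx; apply: is_derive_congr (is_deriveZ a dHx) _ _. Qed.

Lemma is_derive_translate H x v w a : is_derive (w + x) v H a ->
  is_derive x v (fun y => H (w + y)) a.
Proof.
have E : (fun h => h^-1 *: ((H \o shift (w + x)) (h *: v) - H (w + x)))
   = (fun h => h^-1 *: (((fun y => H (w + y)) \o shift x) (h *: v) - H (w + x))).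
  by apply/funext => h; rewrite /= addrCA.
by move=> [dH Ha]; split; [move: dH; rewrite /derivable E|rewrite -Ha /derive E].
Qed.

Lemma is_derive_difference_quotient H w x v a b (h : R) :
  is_derive (w + x) v H a -> is_derive x v H b ->
  is_derive x v (fun y => (H (w + y) - H y) / h) ((a - b) / h).
Proof.
move=> /is_derive_translate Ha Hb.
apply: is_derive_congr (is_derive_scaled h^-1 (is_deriveB Ha Hb)) _ _ => [y|];
by rewrite mulrC.
Qed.

End LinearHelpers.

(** * Derivatives of Bernstein polynomials and difference quotients *)

Section BernsteinDerivatives.
Context {R : realType} {n d : nat} (L : R) (M : nat).
Hypotheses (L0 : 0 < L) (M0 : (0 < M)%N).
Local Notation I := ('I_n * 'I_d)%type.
Local Notation Mat := 'M[R]_(n, d).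
Local Notation bernstein := (bernstein L M).
Local Notation dquot := (dquot L M).
Local Notation mesh := (mesh L M).
Implicit Types (c : I) (x y : Mat) (H G : Mat -> R) (cs ds : seq I) (m : I -> nat).

Definition dquots H ds := foldr dquot H ds.

Definition partials H ds := foldr partial H ds.

Variable cs : seq I.
Hypotheses (ucs : uniq cs) (incs : forall c, c \in cs).

Lemma is_derive_scaled_bernstein a m c H x : (0 < m c)%N ->
  is_derive x (dir c) (fun y => a * bernstein m cs H y)
    (a * ((m c)%:R / M%:R) * bernstein (fun c' => (m c' - (c' == c))%N) cs (dquot c H) x).
Proof.
move=> mc; rewrite -mulrA; apply: is_derive_scaled; exact: is_derive_bernstein.
Qed.

(** The scalar [a] and the degrees [m] are arbitrary so that the claim is stable under
    differentiation, which changes both. *)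
Lemma Ck_on_bernstein k a m H : continuous H -> (forall c, k <= m c)%N ->
  Ck_on k setT (fun x => a * bernstein m cs H x).
Proof.
elim: k a m H => [|k IH] a m H cH km /=.
  by split=> // x _; apply: continuous_scaled; exact: continuous_bernstein.
split; first by move=> x _; apply: continuous_scaled; exact: continuous_bernstein.
move=> c; have mc : (0 < m c)%N by rewrite (leq_trans _ (km c)).
have D x := is_derive_scaled_bernstein a H x mc.
split => [x _|]; first by have [] := D x.
rewrite (_ : partial c _ = fun x => a * ((m c)%:R / M%:R) *
    bernstein (fun c' => (m c' - (c' == c))%N) cs (dquot c H) x); last first.
  by apply/funext => x; have [_] := D x.
apply: IH => [|c']; first exact: continuous_dquot.
by have := km c'; case: (c' == c); rewrite ?subn0 ?subn1; lia.
Qed.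

(** Every derivative contributes a factor [m c / M] with [M - k <= m c]. Bounding all these factors
    by [1 - k / M] is enough, since [k] is fixed while [M] grows. *)
Lemma partials_bernstein k G ds : (size ds <= k)%N -> (k <= M)%N ->
  exists a m, [/\ (1 - k%:R / M%:R) ^+ size ds <= a <= 1,
    forall c, (M - size ds <= m c <= M)%N &
    partials (bernstein (fun=> M) cs G) ds = (fun x => a * bernstein m cs (dquots G ds) x)].
Proof.
move=> + kM; elim: ds => [_|c ds IH sk].
  exists 1, (fun=> M); split => [|c|]; rewrite /= ?expr0 ?lexx ?subn0 ?leqnn//.
  by apply/funext => x; rewrite mul1r.
have [|a [m [/andP[al a1] mM E]]] := IH; first exact: ltnW.
have /andP[ml mu] := mM c.
have mc : (0 < m c)%N by apply: leq_trans ml; rewrite subn_gt0 (leq_trans sk).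
have Mr0 : 0 < M%:R :> R by rewrite ltr0n.
have k1 : 0 <= 1 - k%:R / M%:R :> R by rewrite subr_ge0 ler_pdivrMr// mul1r ler_nat.
exists (a * ((m c)%:R / M%:R)), (fun c' => (m c' - (c' == c))%N); split.
- have a0 : 0 <= a by apply: le_trans al; rewrite exprn_ge0.
  rewrite mulr_ile1 ?divr_ge0 ?ler_pdivrMr ?mul1r ?ler_nat// andbT.
  rewrite /= exprSr ler_pM ?exprn_ge0// -[X in X - _](@divff _ M%:R) ?gt_eqF//.
  rewrite -mulrBl ler_pM2r ?invr_gt0// lerBlDr -natrD ler_nat.
  by move: ml sk; rewrite /=; lia.
- move=> c'; have /andP[] := mM c'; rewrite /=.
  have [->|_] := eqVneq c' c; lia.
- rewrite /partials /= -/(partials _ ds) E.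
  by apply/funext => x; have [_] := is_derive_scaled_bernstein a (dquots G ds) x mc.
Qed.

Lemma dquots_rcons H ds c : dquots H (rcons ds c) = dquot c (dquots H ds).
Proof.
rewrite /dquots foldr_rcons; elim: ds => //= c' ds ->.
exact: dquotC.
Qed.

Lemma is_derive_dquots c G ds : (forall y, derivable G y (dir c)) -> forall x,
  is_derive x (dir c) (dquots G ds) (dquots (partial c G) ds x).
Proof.
move=> dG; elim: ds => [|c' ds IH] x /=; first exact: derivableP.
exact: is_derive_difference_quotient.
Qed.

(* The innermost derivative is peeled off first, so that the mean value theorem
   is applied to difference quotients and no exchange of partial derivatives is
   needed. *)
Lemma dquots_mean_value ds G y : Ck_on (size ds) setT G ->
  exists2 z, (forall c, coord c y <= coord c z <= coord c y + (size ds)%:R * mesh) &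
    dquots G ds y = partials G ds z.
Proof.
have h0 := mesh_gt0 L0 M0.
elim/last_ind: ds G y => [|ds c IH] G y.
  by move=> _; exists y => // c; rewrite mul0r addr0 lexx.
rewrite size_rcons => -[_ /(_ c) [dG CG]].
have dGT x : derivable G x (dir c) by exact: dG.
have D := is_derive_dquots ds dGT.
have [|s /andP[s0 sh] e] := @mean_value_line _ _ _ (dquots G ds) y (dir c) _ (ltW h0).
  by move=> x; have [] := D x.
have [z zb ez] := IH _ (s *: dir c + y) CG.
exists z => [c'|]; last first.
  rewrite dquots_rcons /dquot e mulrAC mulfV ?gt_eqF// mul1r.
  by rewrite derive_val ez /partials foldr_rcons.
have /andP[zl zu] := zb c'; move: zl zu; rewrite -natr1 mulrDl mul1r.
have [->|cc'] := eqVneq c' c; first by rewrite coordDZ_same; lra.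
by rewrite coordDZ//; lra.
Qed.

End BernsteinDerivatives.

Lemma bernoulli_inequality (R : realFieldType) (s : nat) (u : R) : 0 <= u <= 1 ->
  1 - s%:R * u <= (1 - u) ^+ s.
Proof.
move=> /andP[u0 u1]; elim: s => [|s IH]; first by rewrite expr0 mul0r subr0.
rewrite exprS -natr1; have : (1 - u) * (1 - s%:R * u) <= (1 - u) * (1 - u) ^+ s.
  by rewrite ler_wpM2l ?subr_ge0.
apply: le_trans; rewrite -subr_ge0.
rewrite (_ : _ - _ = s%:R * u ^+ 2); last by ring.
by rewrite mulr_ge0 ?sqr_ge0.
Qed.

(** * Quantitative error of the Bernstein operators on the box *)

Section ErrorEstimates.
Context {R : realType} {n d : nat} (L : R) (M : nat).
Hypotheses (L0 : 0 < L) (M0 : (0 < M)%N).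
Local Notation I := ('I_n * 'I_d)%type.
Local Notation Mat := 'M[R]_(n, d).
Local Notation bernstein := (bernstein L M).
Local Notation bern_coord := (bern_coord L M).
Local Notation node := (node L M).
Local Notation mesh := (mesh L M).
Implicit Types (c : I) (x y : Mat) (H G : Mat -> R) (cs ds : seq I) (m : I -> nat).

Lemma node_bound l : (l <= M)%N -> `|node l| <= L.
Proof.
move=> lM; have Mr0 : 0 < M%:R :> R by rewrite ltr0n.
have h : 0 <= l%:R * mesh <= 2 * L.
  rewrite mulr_ge0 ?(ltW (mesh_gt0 _ _))//= /mesh mulrCA ger_pMr ?mulr_gt0//.
  by rewrite ler_pdivrMr// mul1r ler_nat.
by rewrite ler_norml /node; lra.
Qed.

Lemma tau_bound c x : box L x -> 0 <= tau L c x <= 1.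
Proof.
move=> /(_ c); rewrite ler_norml /tau => /andP[xl xu].
rewrite divr_ge0 ?ler_pdivrMr ?mulr_gt0// ?mul1r /=; try lra.
Qed.

Lemma box_upd c x a : box L x -> `|a| <= L -> box L (upd c x a).
Proof. by move=> bx aL c'; rewrite coord_upd; case: eqP. Qed.

Lemma bern_coord_norm k c H x (C : R) : (k <= M)%N -> box L x ->
  (forall y, box L y -> `|H y| <= C) -> `|bern_coord k c H x| <= C.
Proof.
move=> kM bx HC; rewrite -[C](bern_cst k C (tau L c x)).
apply: bern_norm => [|l lk]; first exact: tau_bound.
by apply: HC; apply: box_upd => //; apply: node_bound; exact: leq_trans kM.
Qed.

Lemma bernstein_norm m cs H x (C : R) : (forall c, m c <= M)%N -> box L x ->
  (forall y, box L y -> `|H y| <= C) -> `|bernstein m cs H x| <= C.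
Proof.
move=> mM; elim: cs x => [|c cs IH] x bx HC /=; first exact: HC.
by apply: bern_coord_norm => // y by_; exact: IH.
Qed.

Lemma bernsteinB m cs H G x :
  bernstein m cs (fun y => H y - G y) x = bernstein m cs H x - bernstein m cs G x.
Proof.
elim: cs x => //= c cs IH x; rewrite /bern_coord -bernB; apply: eq_bern => l.
exact: IH.
Qed.

(** Chebyshev's argument: nodes within [delta] contribute at most [e], and at the others the trivial
    bound [2 * C] is at most [2 * C / delta ^ 2] times the squared distance, whose mean is the
    second moment. The parameter [q] bounds the degrees lost by differentiation. *)
Lemma bern_coord_close (delta e C : R) k q c H x : 0 < delta ->
  (forall x y, box L x -> ball x delta y -> `|H x - H y| <= e) ->
  (forall x, box L x -> `|H x| <= C) ->
  (M - q <= k <= M)%N -> box L x ->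
  `|bern_coord k c H x - H x| <= e + 2 * C / delta ^+ 2 * (4 * L ^+ 2 * (1 + q%:R ^+ 2) / M%:R).
Proof.
move=> d0 Hc HC /andP[qk kM] bx.
have Mr0 : 0 < M%:R :> R by rewrite ltr0n.
have e0 : 0 <= e by rewrite -(normr0 R) -(subrr (H x)) Hc//; exact: ballxx.
have C0 : 0 <= C by apply: le_trans (HC _ bx).
have t01 := tau_bound c bx; set t := tau L c x in t01.
have K0 : 0 <= 2 * C / delta ^+ 2 by rewrite divr_ge0 ?mulr_ge0 ?exprn_ge0// ltW.
rewrite -[H x](bern_cst k _ t) /bern_coord -bernB.
pose w l := e + 2 * C / delta ^+ 2 * (mesh ^+ 2 * (l%:R - M%:R * t) ^+ 2).
apply: le_trans (bern_norm (h := w) t01 _) _.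
  rewrite /w => l lk; have lM := leq_trans lk kM.
  have bu : box L (upd c x (node l)) by apply: box_upd => //; exact: node_bound.
  have -> : mesh ^+ 2 * (l%:R - M%:R * t) ^+ 2 = (node l - coord c x) ^+ 2.
    rewrite -exprMn; congr (_ ^+ 2); rewrite /node /t /tau /mesh; field.
    by rewrite !gt_eqF.
  have [lt_d|ge_d] := ltP `|node l - coord c x| delta.
    apply: (@le_trans _ _ e); last by rewrite lerDl mulr_ge0 ?sqr_ge0.
    rewrite distrC Hc//.
    split=> // i j; rewrite -ball_normE /ball_ /upd /= !mxE opprD addrCA subrr addr0 normrN.
    rewrite normrM; case: (_ && _); rewrite ?normr1 ?mulr1// normr0 mulr0//.
  rewrite (le_trans (ler_normB _ _))// -[X in X <= _]add0r lerD//.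
  rewrite (le_trans (lerD (HC _ bu) (HC _ bx)))// (_ : C + C = 2 * C); last by ring.
  rewrite [leRHS]mulrAC ler_pdivlMr ?exprn_gt0// ler_wpM2l ?mulr_ge0//.
  by rewrite -[(_ - _) ^+ 2]real_normK ?num_real// lerXn2r ?nnegrE// ltW.
rewrite /w bernD bern_cst !bernZ bern_square lerD2l ler_wpM2l//.
have -> : k%:R * t - M%:R * t = - ((M - k)%N%:R * t) by rewrite natrB//; ring.
have kq : (M - k)%N%:R <= q%:R :> R by rewrite ler_nat leq_subCl.
have kMr : k%:R <= M%:R :> R by rewrite ler_nat.
have ME : 1 <= M%:R :> R by rewrite ler1n.
have /andP[t0 t1] := t01.
(* The variance is at most [M] and the squared bias at most [q ^ 2 <= M * q ^ 2]; the factor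
   [mesh ^ 2] equals [4 * L ^ 2 / M ^ 2]. *)
rewrite (_ : 4 * _ * _ / _ = mesh ^+ 2 * (M%:R * (1 + q%:R ^+ 2))); last first.
  by rewrite /mesh; field; rewrite gt_eqF.
rewrite ler_wpM2l ?exprn_ge0 ?(ltW (mesh_gt0 _ _))// sqrrN [leRHS]mulrDr mulr1 lerD//.
  rewrite (le_trans _ kMr)// -mulrA ler_piMr// mulr_ile1// ?subr_ge0//.
  by rewrite lerBlDr lerDl.
have h1 : ((M - k)%N%:R * t) ^+ 2 <= q%:R ^+ 2.
  have a0 : 0 <= (M - k)%N%:R * t by apply: mulr_ge0.
  apply: lerXn2r => //; rewrite ?nnegrE//.
  by rewrite (le_trans _ kq)// ler_piMr.
by rewrite (le_trans h1)// ler_peMl// exprn_ge0.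
Qed.

(** A telescoping sum over the coordinates: a one-coordinate operator does not increase a bound
    valid on the box, so the single errors simply add up. *)
Lemma bernstein_close (e : R) m cs H x :
  (forall c, m c <= M)%N ->
  (forall c x, box L x -> `|bern_coord (m c) c H x - H x| <= e) ->
  box L x -> `|bernstein m cs H x - H x| <= (size cs)%:R * e.
Proof.
move=> mM BH; elim: cs x => [|c cs IH] x bx; first by rewrite /= subrr normr0 mul0r.
rewrite /= -natr1 mulrDl mul1r.
rewrite (_ : _ - _ = (bern_coord (m c) c (bernstein m cs H) x - bern_coord (m c) c H x)
   + (bern_coord (m c) c H x - H x)); last by ring.
rewrite (le_trans (ler_normD _ _))// lerD ?BH//.
rewrite /bern_coord -bernB -/(bern_coord (m c) c (fun y => bernstein m cs H y - H y) x).
exact: bern_coord_norm.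
Qed.

End ErrorEstimates.

Section BernsteinApproximation.
Context {R : realType} {n d : nat}.
Local Notation I := ('I_n * 'I_d)%type.
Local Notation Mat := 'M[R]_(n, d).
Implicit Types (c : I) (x y : Mat) (H G : Mat -> R) (cs ds : seq I).

Lemma Ck_on_partials k ds G : (size ds <= k)%N -> Ck_on k setT G ->
  continuous (partials G ds).
Proof.
elim/last_ind: ds k G => [|ds c IH] k G.
  by case: k => [|k] _ [cG _] x; apply: cG; rewrite inE.
rewrite size_rcons; case: k => // k sk [_ /(_ c) [_ CG]].
by rewrite /partials foldr_rcons; exact: IH CG.
Qed.

Lemma bernstein_approx (L : R) k G ds (e : R) : 0 < L -> (size ds <= k)%N ->
  Ck_on k setT G -> 0 < e ->
  \forall M \near \oo, forall x, box L x ->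
   `|partials (bernstein L M (fun=> M) (enum {: I}) G) ds x - partials G ds x| <= e.
Proof.
move=> L0 sk CG e0; set H := partials G ds.
have cH : continuous H by exact: Ck_on_partials CG.
have CdG : Ck_on (size ds) setT G by exact: Ck_on_le CG.
have cbox := @compact_box R n d L.
have [C HC] := @compact_bounded_image R Mat (box L) H cbox cH.
have C0 : 0 <= C.
  by apply: le_trans (HC 0 _) => // c; rewrite /coord mxE normr0 ltW.
(* One quarter of [e] pays for the factor [a], one for replacing difference quotients by
   derivatives, and two for the [N] coordinates at [2 * e1] each. The successor keeps the
   denominator positive. *)
pose N := #|{: I}|; pose e1 := e / 4 / N.+1%:R.
have e10 : 0 < e1 by rewrite !divr_gt0.
have [delta d0 Hd] := @compact_uniformly_continuous R Mat (box L) H e1 cbox cH e10.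
pose A := 2 * C / delta ^+ 2 * (4 * L ^+ 2 * (1 + k%:R ^+ 2)).
have small (a b : R) : 0 < b -> \forall M \near \oo, a / M%:R <= b.
  move=> b0; near=> M; have MR : 0 < M%:R :> R by rewrite ltr0n; near: M; exact: nbhs_infty_gt.
  rewrite ler_pdivrMr// mulrC -ler_pdivrMr//; near: M; exact: nbhs_infty_ger.
near=> M.
have M0 : (0 < M)%N by near: M; exact: nbhs_infty_gt.
have kM : (k <= M)%N by near: M; exact: nbhs_infty_ge.
have AM : A / M%:R <= e1 by near: M; exact: small.
have kkM : (k%:R * k%:R * (C + e1)) / M%:R <= e / 4 by near: M; apply: small; rewrite divr_gt0.
have hM : (k%:R * 2 * L) / M%:R <= delta / 2 by near: M; apply: small; rewrite divr_gt0.
have inI c : c \in enum {: I} by rewrite mem_enum.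
have [a [m [/andP[al au] mM ->]]] := partials_bernstein L0 M0 (enum_uniq _) inI G sk kM.
move=> x bx.
have mM' c : (m c <= M)%N by have /andP[] := mM c.
have Dq y : box L y -> `|dquots L M G ds y - H y| <= e1.
  move=> by_; have [z zy ->] := dquots_mean_value L0 M0 y CdG.
  rewrite distrC; apply: Hd => //; split=> // i j.
  have /andP[z1 z2] := zy (i, j); rewrite -ball_normE /ball_ /= ler0_norm ?subr_le0//.
  rewrite opprB ltrBlDl (le_lt_trans z2)// ltrD2l.
  have : (size ds)%:R * mesh L M <= delta / 2.
    rewrite (le_trans _ hM)// /mesh -!mulrA ler_wpM2r ?ler_nat//.
    by rewrite mulr_ge0// divr_ge0// ltW.
  by move=> /le_lt_trans; apply; rewrite ltr_pdivrMr// ltr_pMr// ltr1n.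
have e1e : e1 <= e / 4 by rewrite /e1 ler_pdivrMr// ler_peMr ?ler1n// divr_ge0// ltW.
have E1 : `|bernstein L M m (enum {: I}) (dquots L M G ds) x
    - bernstein L M m (enum {: I}) H x| <= e1.
  by rewrite -bernsteinB; exact: bernstein_norm.
have BH c y : box L y -> `|bern_coord L M (m c) c H y - H y| <= e1 + e1.
  move=> by_; have mk : (M - k <= m c <= M)%N.
    rewrite mM' andbT; have /andP[+ _] := mM c.
    by apply: leq_trans; exact: leq_sub2l.
  have close := bern_coord_close L0 M0 c d0 Hd HC mk by_.
  by rewrite (le_trans close)// lerD2l mulrA.
have E2 : `|bernstein L M m (enum {: I}) H x - H x| <= e / 2.
  have close := bernstein_close L0 M0 (enum {: I}) mM' BH bx.
  rewrite (le_trans close)//.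
  rewrite -cardE -/N -mulr2n mulrnAr -mulr_natr -[e / 2](@divfK _ 4)//.
  have -> : e / 2 / 4 * 4 = e / 4 * 2 by field.
  rewrite ler_wpM2r// /e1 mulrA ler_pdivrMr// mulrC ler_wpM2l// ?ler_nat//.
  by rewrite divr_ge0// ltW.
have E3 : `|bernstein L M m (enum {: I}) (dquots L M G ds) x| <= C + e1.
  apply: bernstein_norm => // y by_; rewrite -[dquots _ _ _ _ _](subrK (H y)) addrC.
  by rewrite (le_trans (ler_normD _ _))// lerD ?HC ?Dq.
have MR : 0 < M%:R :> R by rewrite ltr0n.
(* Bernoulli's inequality makes the lower bound on the product of at most [k] factors linear in
   [1 / M]. *)
have a1 : `|a - 1| <= k%:R * k%:R / M%:R.
  rewrite ler0_norm ?subr_le0// opprB lerBlDr -lerBlDl (le_trans _ al)//.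
  apply: le_trans (bernoulli_inequality (size ds) _).
    rewrite lerB// -[leRHS]mulrA; apply: ler_wpM2r; last by rewrite ler_nat.
    by apply: divr_ge0; exact: ler0n.
  by rewrite divr_ge0//= ler_pdivrMr// mul1r ler_nat.
rewrite (_ : _ - _ = (a - 1) * bernstein L M m (enum {: I}) (dquots L M G ds) x
  + (bernstein L M m (enum {: I}) (dquots L M G ds) x - bernstein L M m (enum {: I}) H x)
  + (bernstein L M m (enum {: I}) H x - H x)); last by rewrite /H; ring.
rewrite (_ : e = e / 4 + e / 4 + e / 2); last by field.
rewrite (le_trans (ler_normD _ _))// lerD// (le_trans (ler_normD _ _))//.
rewrite lerD//; last exact: le_trans e1e.
rewrite normrM (le_trans _ kkM)// mulrAC ler_pM//.
Unshelve. all: by end_near. Qed.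

End BernsteinApproximation.

(** * Bernstein polynomials as sums of separable products *)

Section SeparableSpan.
Context {R : realType} {n d : nat}.
Local Notation I := ('I_n * 'I_d)%type.
Local Notation Mat := 'M[R]_(n, d).
Implicit Types (c : I) (x y : Mat) (H F G : Mat -> R) (cs : seq I).

(** The inductive form replaces explicit finite sums: closure properties follow by induction,
    without index sets for the summands. *)
Inductive sep_span : (Mat -> R) -> Prop :=
| sep_span_prod F a q :
    (forall x, F x = a * \prod_i sep_poly (q i) (row i x)) -> sep_span F
| sep_span_add F G H : sep_span F -> sep_span G ->
    (forall x, H x = F x + G x) -> sep_span H.

Lemma eq_sep_span F G : F =1 G -> sep_span F -> sep_span G.
Proof. by move/funext ->. Qed.

Lemma sep_span_cst a : sep_span (fun=> a).
Proof.
apply: (@sep_span_prod _ a (fun _ _ => 1)) => x.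
by rewrite big1 ?mulr1// => i _; apply: big1 => j _; rewrite hornerC.
Qed.

Lemma sep_span_mul c (p : {poly R}) F :
  sep_span F -> sep_span (fun x => p.[coord c x] * F x).
Proof.
elim=> [{}F a q E|{}F G H _ IHF _ IHG E]; last first.
  by apply: sep_span_add IHF IHG _ => x; rewrite E mulrDr.
pose q' i j := if (i, j) == c then p * q i j else q i j.
apply: (@sep_span_prod _ a q') => x; rewrite E mulrCA; congr (a * _).
rewrite /sep_poly !pair_bigA /= (bigD1 c) //= [in RHS](bigD1 c) //= mulrA; congr (_ * _).
  by rewrite /q' -surjective_pairing eqxx hornerM mxE.
apply: eq_bigr => b /negPf bc.
by rewrite /q' -surjective_pairing bc.
Qed.

Variables (L : R) (M : nat).

Lemma sep_span_bern k c (K : nat -> Mat -> R) : (forall l, sep_span (K l)) ->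
  sep_span (fun x => bern k (K^~ x) (tau L c x)).
Proof.
elim: k K => [|k IH] K sK; first exact: sK.
pose p : {poly R} := (2 * L)^-1 *: ('X + L%:P).
have pE x : p.[coord c x] = tau L c x by rewrite /p !hornerE mulrC.
have s1 := sep_span_mul c (1 - p) (IH K sK).
have s2 := sep_span_mul c p (IH _ (fun l => sK l.+1)).
by apply: sep_span_add s1 s2 _ => x; rewrite /= hornerD hornerN hornerC pE.
Qed.

Lemma sep_span_bernstein_mix m cs H y : uniq cs ->
  sep_span (fun x => bernstein L M m cs H (mix cs x y)).
Proof.
elim: cs y => [|c cs IH] y /=; first by move=> _; exact: sep_span_cst.
move=> /andP[ccs ucs].
apply: eq_sep_span (sep_span_bern (m c) c (fun l => IH (upd c y (node L M l)) ucs)) => x.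
rewrite /bern_coord /tau coord_upd eqxx; apply: eq_bern => l.
by rewrite upd_upd upd_mix.
Qed.

Lemma sep_span_bernstein m H : sep_span (bernstein L M m (enum {: I}) H).
Proof.
apply: eq_sep_span (sep_span_bernstein_mix m H 0 (enum_uniq {: I})) => x.
by congr bernstein; apply: coordP => c; rewrite coord_mix mem_enum.
Qed.

Lemma pis_sum_row_perm M' (phi : 'rV[R]_d -> 'rV[R]_M') F :
  monomial_map n phi -> sep_span F ->
  poly_in_sums phi (fun x => \sum_(s : 'S_n) F (row_perm s x)).
Proof.
move=> mphi; elim=> [{}F a q E|{}F G H _ IHF _ IHG E]; last first.
  apply: eq_pis (pisD IHF IHG) => x.
  by rewrite -big_split; apply: eq_bigr => s _; rewrite E.
have low s := @monomial_map_low_degree R n d M' phi s mphi.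
apply: eq_pis (pisZ a (pis_sum_perm_sep low q)) => x.
rewrite mulr_sumr; apply: eq_bigr => s _; rewrite E; congr (a * _).
by apply: eq_bigr => i _; congr sep_poly; apply/rowP => j; rewrite !mxE.
Qed.

(** A symmetric function equals its own average over the permutations, and averaging brings each
    separable summand into the algebra. *)
Lemma pis_symmetric M' (phi : 'rV[R]_d -> 'rV[R]_M') F :
  monomial_map n phi -> sep_span F ->
  (forall (s : 'S_n) x, F (row_perm s x) = F x) -> poly_in_sums phi F.
Proof.
move=> mphi sF symF.
apply: eq_pis (pisZ (n`!%:R)^-1 (pis_sum_row_perm mphi sF)) => x.
rewrite (eq_bigr (fun=> F x)) => [|s _]; last exact: symF.
rewrite sumr_const card_Sn -[F x *+ _]mulr_natl. rewrite mulKf// pnatr_eq0 -lt0n fact_gt0//.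
Qed.

End SeparableSpan.

(** * Functions of class C^k *)

Lemma near_eq_continuous (T U : topologicalType) (f g : T -> U) (x : T) :
  (\forall y \near x, f y = g y) -> {for x, continuous f} -> {for x, continuous g}.
Proof.
move=> fg cf; rewrite /prop_for /continuous_at -(nbhs_singleton fg).
by apply: cvg_trans cf; exact: near_eq_cvg.
Qed.

Section PositivePart.
Context {R : realType} {V : normedModType R}.
Implicit Types (F : V -> R) (x v : V).

(** With [k < K] the power of the positive part keeps class [C^k]. A cutoff of finite order needs no
    more, so no flat exponential is required. *)
Definition pospow K F x : R := Num.max 0 (F x) ^+ K.

Lemma continuous_at_pospow K F x : {for x, continuous F} ->
  {for x, continuous (pospow K F)}.
Proof.
move=> cF.
have cm : {for x, continuous (fun y => Num.max 0 (F y))}.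
  by apply: continuous_max => //; exact: cvg_cst.
elim: K => [|K IH].
  rewrite (_ : pospow 0 F = cst 1); first exact: cvg_cst.
  by apply/funext => y; rewrite /pospow expr0.
rewrite (_ : pospow K.+1 F = (fun y => Num.max 0 (F y)) \* pospow K F).
  exact: continuousM.
by apply/funext => y; rewrite /pospow exprS.
Qed.

(* Differentiability at the zeros of F comes from pospow K.+2 F = F * pospow K.+1 F,
   where the second factor is continuous and vanishes. *)
Lemma is_derive_pospow K F x v dF : {for x, continuous F} -> is_derive x v F dF ->
  is_derive x v (pospow K.+2 F) (K.+2%:R * pospow K.+1 F x * dF).
Proof.
move=> cF [DF dFE]; have [F0|F0|F0] := ltgtP (F x) 0.
- have nF : \forall y \near x, F y < 0 by apply: cvgr_lt F0; exact: cF.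
  rewrite /pospow max_l ?ltW// exprS mul0r mulr0 mul0r.
  apply: near_eq_is_derive (is_derive_cst (0 : R) x v).
  by apply: filterS nF => y Fy; rewrite max_l ?ltW// expr0n.
- have nF : \forall y \near x, 0 < F y by apply: cvgr_gt F0; exact: cF.
  rewrite /pospow max_r ?ltW//.
  apply: near_eq_is_derive (is_deriveX K.+2 (DeriveDef DF dFE)).
  by apply: filterS nF => y Fy; rewrite max_r ?ltW// fctE.
have p0 : pospow K.+1 F x = 0 by rewrite /pospow F0 maxxx exprS mul0r.
have cp := @continuous_at_pospow K.+1 F x cF.
have E : (fun h : R => h^-1 *: ((pospow K.+2 F \o shift x) (h *: v) - pospow K.+2 F x))
  = (fun h => (h^-1 *: ((F \o shift x) (h *: v) - F x)) * pospow K.+1 F (h *: v + x)).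
  apply/funext => h; rewrite /= F0 subr0 {2}/pospow F0 maxxx exprS mul0r subr0.
  rewrite /GRing.scale /= -mulrA; congr (_ * _); rewrite /pospow.
  have [Fh|Fh] := leP 0 (F (h *: v + x)); first by rewrite exprS.
  by rewrite !exprS !mul0r mulr0.
have lim0 : h^-1 *: ((pospow K.+2 F \o shift x) (h *: v) - pospow K.+2 F x) @[h --> 0^'] -->
    (dF * pospow K.+1 F x : R).
  rewrite E; apply: cvgM; first by rewrite -dFE; exact: DF.
  apply: (@cvg_comp _ _ _ (fun h : R => h *: v + x) (pospow K.+1 F) _ (nbhs x)); last exact: cp.
  apply: cvg_within_filter.
  have : h *: v + x @[h --> (0 : R)] --> 0 *: v + x.
    by apply: cvgD; [apply: cvgZr_tmp; exact: cvg_id|exact: cvg_cst].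
  by rewrite scale0r add0r.
rewrite p0 mulr0 in lim0; rewrite p0 mulr0 mul0r; split; first by apply/cvg_ex; exists 0.
exact: cvg_lim lim0.
Qed.

End PositivePart.

Section CkClosure.
Context {R : realType} {n d : nat}.
Local Notation I := ('I_n * 'I_d)%type.
Local Notation Mat := 'M[R]_(n, d).
Implicit Types (U W : set Mat) (F G : Mat -> R) (k : nat) (c : I).

Lemma Ck_on_subset k U W F : W `<=` U -> Ck_on k U F -> Ck_on k W F.
Proof.
move=> WU; have WU' x : x \in W -> x \in U by rewrite !inE; exact: WU.
elim: k F => [|k IH] F /= [cF DF].
  by split=> // x /WU'; exact: cF.
split=> [x /WU'|c]; first exact: cF.
by have [D C] := DF c; split=> [x /WU|]; [exact: D|exact: IH].
Qed.

(** Continuity and derivability in [Ck_on] are taken in the whole space at each point of the set, so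
    the class can be checked pointwise. *)
Lemma Ck_on_local k F : (forall x, exists2 W, W x & Ck_on k W F) -> Ck_on k setT F.
Proof.
elim: k F => [|k IH] F loc /=.
  by split=> // x _; have [W Wx [cF _]] := loc x; apply: cF; rewrite inE.
split; first by move=> x _; have [W Wx [cF _]] := loc x; apply: cF; rewrite inE.
move=> c; split=> [x _|].
  by have [W Wx [_ /(_ c) [D _]]] := loc x; exact: D.
by apply: IH => x; have [W Wx [_ /(_ c) [_ C]]] := loc x; exists W.
Qed.

Lemma eq_Ck_on k U F G : open U -> {in U, F =1 G} -> Ck_on k U F -> Ck_on k U G.
Proof.
move=> oU; have nU x : x \in U -> \forall y \near x, U y.
  by rewrite inE => Ux; exact: open_nbhs_nbhs.
have nFG F' G' x : {in U, F' =1 G'} -> x \in U -> \forall y \near x, F' y = G' y.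
  by move=> FG' /nU; apply: filterS => y Uy; apply: FG'; rewrite inE.
have cFG F' G' : {in U, F' =1 G'} -> {in U, continuous F'} -> {in U, continuous G'}.
  move=> FG' cF x xU.
  exact: (near_eq_continuous (nFG _ _ _ FG' xU) (cF x xU)).
elim: k F G => [|k IH] F G FG /= [cF DF]; first by split=> //; exact: cFG cF.
split=> [|c]; first exact: cFG cF.
have [D C] := DF c; split=> [x Ux|]; last by apply: IH C; exact: eq_partial.
by apply: near_eq_derivable (D x Ux); apply: (nFG _ _ _ FG); rewrite inE.
Qed.

Lemma Ck_on_continuous k U F x : Ck_on k U F -> U x -> {for x, continuous F}.
Proof. by case: k => [|k] [cF _] Ux; apply: cF; rewrite inE. Qed.

Lemma Ck_on_cst k U a : Ck_on k U (fun=> a).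
Proof.
elim: k a => [|k IH] a /=; first by split=> // x _; exact: cst_continuous.
split=> [x _|c]; first exact: cst_continuous.
split=> [x _|]; first exact: derivable_cst.
rewrite (_ : partial c _ = fun=> 0)//; apply/funext => x.
exact: derive_cst.
Qed.

Lemma Ck_onD k U F G : open U -> Ck_on k U F -> Ck_on k U G ->
  Ck_on k U (fun x => F x + G x).
Proof.
move=> oU; elim: k F G => [|k IH] F G [cF DF] [cG DG].
  by split=> // x xU; apply: continuousD; [exact: cF|exact: cG].
split=> [x xU|c]; first by apply: continuousD; [exact: cF|exact: cG].
have [dF CF] := DF c; have [dG CG] := DG c; split=> [x Ux|].
  by apply: derivableD; [exact: dF|exact: dG].
apply: eq_Ck_on (IH _ _ CF CG) => // x; rewrite inE => Ux.
by rewrite /partial deriveD//; [exact: dF|exact: dG].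
Qed.

Lemma Ck_onM k U F G : open U -> Ck_on k U F -> Ck_on k U G ->
  Ck_on k U (fun x => F x * G x).
Proof.
move=> oU; elim: k F G => [|k IH] F G CF0 CG0.
  split=> // x; rewrite inE => Ux.
  by apply: continuousM; [exact: Ck_on_continuous CF0 Ux|exact: Ck_on_continuous CG0 Ux].
split=> [x|c].
  rewrite inE => Ux.
  by apply: continuousM; [exact: Ck_on_continuous CF0 Ux|exact: Ck_on_continuous CG0 Ux].
have [_ /(_ c) [dF CF]] := CF0; have [_ /(_ c) [dG CG]] := CG0.
split=> [x Ux|]; first by apply: derivableM; [exact: dF|exact: dG].
have CF1 := Ck_on_le (leqnSn k) CF0; have CG1 := Ck_on_le (leqnSn k) CG0.
apply: eq_Ck_on (Ck_onD oU (IH _ _ CF1 CG) (IH _ _ CG1 CF)) => // x; rewrite inE => Ux.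
by rewrite /partial (deriveM (dF x Ux) (dG x Ux)).
Qed.

Lemma Ck_onZ k U a F : open U -> Ck_on k U F -> Ck_on k U (fun x => a * F x).
Proof. by move=> oU CF; apply: Ck_onM => //; exact: Ck_on_cst. Qed.

Lemma Ck_onB k U F G : open U -> Ck_on k U F -> Ck_on k U G ->
  Ck_on k U (fun x => F x - G x).
Proof.
move=> oU CF CG; apply: eq_Ck_on (Ck_onD oU CF (Ck_onZ (-1) oU CG)) => // x _.
by rewrite mulN1r.
Qed.

Lemma Ck_on_sum k U (J : Type) (s : seq J) (F : J -> Mat -> R) : open U ->
  (forall j, Ck_on k U (F j)) -> Ck_on k U (fun x => \sum_(j <- s) F j x).
Proof.
move=> oU CF; elim: s => [|j s IH].
  by apply: eq_Ck_on (Ck_on_cst k U 0) => // x _; rewrite big_nil.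
by apply: eq_Ck_on (Ck_onD oU (CF j) IH) => // x _; rewrite big_cons.
Qed.

Lemma Ck_on_coord k U c : Ck_on k U (coord c).
Proof.
case: k => [|k]; first by split=> // x _; exact: continuous_coord.
split=> [x _|c']; first exact: continuous_coord.
have D x := is_derive_coord c x (dir c' : Mat).
split=> [x _|]; first by have [] := D x.
rewrite (_ : partial c' _ = fun=> coord c (dir c' : Mat)); first exact: Ck_on_cst.
by apply/funext => x; have [] := D x.
Qed.

Lemma Ck_on_pospow k K U F : open U -> (k < K)%N -> Ck_on k U F ->
  Ck_on k U (pospow K F).
Proof.
move=> oU; elim: k K F => [|k IH] K F kK CF0.
  split=> // x; rewrite inE => Ux; apply: continuous_at_pospow.
  exact: Ck_on_continuous CF0 Ux.
case: K kK => [//|[//|K]] kK; split=> [x|c].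
  rewrite inE => Ux; apply: continuous_at_pospow.
  exact: Ck_on_continuous CF0 Ux.
have [_ /(_ c) [dF CF]] := CF0.
have D x (Ux : U x) := is_derive_pospow K (Ck_on_continuous CF0 Ux) (derivableP (dF x Ux)).
split=> [x Ux|]; first by have [] := D x Ux.
have CF1 := Ck_on_le (leqnSn k) CF0.
apply: eq_Ck_on (Ck_onM oU (Ck_onZ K.+2%:R oU (IH K.+1 F kK CF1)) CF) => // x.
by rewrite inE => Ux; have [_ <-] := D x Ux.
Qed.

Lemma Ck_on_row_perm k F (s : 'S_n) : Ck_on k setT F ->
  Ck_on k setT (fun x => F (row_perm s x)).
Proof.
have cs : continuous (row_perm s : Mat -> Mat).
  move=> x A /= /(nbhs_ballP (row_perm s x)) [e e0 eA].
  apply/nbhs_ballP; exists e => // y [_ xy]; apply: eA; split => // i j.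
  by rewrite !mxE; exact: xy.
have cFs G : continuous G -> continuous (fun x => G (row_perm s x)).
  by move=> cG x; apply: (@continuous_comp _ _ _ (row_perm s) G x); [exact: cs|exact: cG].
elim: k F => [|k IH] F [cF DF].
  by split=> // x _; apply: cFs => y; apply: cF; rewrite inE.
split=> [x _|c]; first by apply: cFs => y; apply: cF; rewrite inE.
have [c' dc] : exists c', row_perm s (dir c) = dir c' :> Mat.
  exists (perm_coord s^-1 c); apply: coordP => b; rewrite coord_row_perm !coord_dir.
  have K : perm_coord s (perm_coord s^-1 c) = c by rewrite /perm_coord permKV; case: c.
  by rewrite -{1}K (inj_eq (@perm_coord_inj n d s)).
have [dF CF] := DF c'.
have E x : (fun h => h^-1 *: ((F \o shift (row_perm s x)) (h *: dir c') - F (row_perm s x)))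
   = (fun h => h^-1 *: (((fun y => F (row_perm s y)) \o shift x) (h *: dir c) - F (row_perm s x))).
  apply/funext => h /=; rewrite -dc; congr (_ *: (F _ - _)).
  by apply: coordP => b; rewrite coord_row_perm !coordE !coord_row_perm.
split=> [x _|]; first by have := dF (row_perm s x) Logic.I; rewrite /derivable E.
rewrite (_ : partial c _ = fun x => partial c' F (row_perm s x)); first exact: IH.
by apply/funext => x; rewrite /partial /derive -E.
Qed.

End CkClosure.

(** * Cutoff functions and symmetric extension to the whole space *)

Section Extension.
Context {R : realType} {n d : nat}.
Local Notation I := ('I_n * 'I_d)%type.
Local Notation Mat := 'M[R]_(n, d).
Implicit Types (U V W : set Mat) (F G : Mat -> R) (k : nat) (c : I).

Lemma bump_function k U v : open U -> U v ->
  exists q : Mat -> R, [/\ Ck_on k setT q, 1 < q v &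
    forall x, ~ U x -> exists W, [/\ open W, W x & forall y, W y -> q y <= 0]].
Proof.
move=> oU Uv; have [r /= r0 rU] : exists2 r, 0 < r & ball v r `<=` U.
  by apply/nbhs_ballP; exact: open_nbhs_nbhs.
(* The value at [v] is 2, and it is at most 0 once some coordinate is [r / 2] away from [v], as
   [8 / r ^ 2 * (r / 2) ^ 2 = 2]. The other half of [r] leaves room for a neighbourhood of each
   point outside [U]. *)
pose q x := 2 + - (8 / r ^+ 2) *
  \sum_(c <- enum {: I}) (coord c x - coord c v) * (coord c x - coord c v).
exists q; split.
- apply: Ck_onD => //; first exact: openT; first exact: Ck_on_cst.
  apply: Ck_onZ; first exact: openT.
  apply: Ck_on_sum => [|c]; first exact: openT.
  have Cc : Ck_on k setT (fun x : Mat => coord c x - coord c v).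
    by apply: Ck_onB; [exact: openT|exact: Ck_on_coord|exact: Ck_on_cst].
  by apply: Ck_onM => //; exact: openT.
- rewrite /q big1 ?mulr0 ?addr0 ?ltr1n// => c _.
  by rewrite subrr mul0r.
move=> x nUx; exists (ball x (r / 2))^°; split.
- exact: open_interior.
- by apply: nbhsx_ballx; rewrite divr_gt0.
move=> y /interior_subset xy.
have [c rc] : exists c, r / 2 <= `|coord c y - coord c v|.
  apply: contrapT => /forallNP H; apply: nUx; apply: rU; split=> // i j.
  rewrite -ball_normE /ball_ /= [r]splitr.
  have [_ /(_ i j)] := xy; rewrite -ball_normE /ball_ /= => h1.
  have := H (i, j) => /negP; rewrite -ltNge /coord /= => h2.
  rewrite (_ : v i j - x i j = - (x i j - y i j) - (y i j - v i j)); last by ring.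
  rewrite (le_lt_trans (ler_normB _ _))// normrN.
  by rewrite ltrD.
have rc2 : (r / 2) ^+ 2 <= \sum_(c <- enum {: I}) (coord c y - coord c v) * (coord c y - coord c v).
  rewrite (big_rem c) ?mem_enum//= -[leLHS]addr0 lerD//.
    rewrite -expr2 -[(_ - _) ^+ 2]real_normK ?num_real//.
    by apply: lerXn2r; rewrite ?nnegrE// divr_ge0// ltW.
  by apply: sumr_ge0 => c' _; rewrite -expr2 sqr_ge0.
rewrite /q mulNr subr_le0.
apply: le_trans (ler_wpM2l _ rc2); last by rewrite divr_ge0 ?exprn_ge0// ltW.
rewrite le_eqVlt; apply/orP; left; apply/eqP; field.
by rewrite gt_eqF.
Qed.

Lemma near_all_seq (T : topologicalType) (J : eqType) (s : seq J) (P : J -> T -> Prop) (x : T) :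
  (forall j, j \in s -> \forall y \near x, P j y) ->
  \forall y \near x, forall j, j \in s -> P j y.
Proof.
elim: s => [|j s IH] H; first by apply: filterE => y j; rewrite in_nil.
have Hj := H j (mem_head _ _).
have Hs := IH (fun i is_ => H i (mem_behead (s := j :: s) is_)).
by apply: filterS2 Hj Hs => y Pj Ps i; rewrite inE => /orP[/eqP->|/Ps].
Qed.

Lemma cutoff_function k U V : compact V -> open U -> V `<=` U ->
  exists chi : Mat -> R, [/\ Ck_on k setT chi, {in V, forall x, chi x = 1} &
    forall x, ~ U x -> exists W, [/\ open W, W x & forall y, W y -> chi y = 0]].
Proof.
move=> cV oU VU.
have /choice[q qP] : forall v : Mat, exists q : Mat -> R, V v ->
    [/\ Ck_on k setT q, 1 < q v &
    forall x, ~ U x -> exists W, [/\ open W, W x & forall y, W y -> q y <= 0]].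
  move=> v; have [Vv|nVv] := pselect (V v); last by exists (fun=> 0).
  by have [q] := @bump_function k U v oU (VU _ Vv); exists q.
have cq v : V v -> continuous (q v).
  by move=> /qP[Cq _ _] x; exact: Ck_on_continuous Cq _.
have : finite_subset_cover V (fun v => [set x | 1 < q v x]) V.
  have : cover_compact V by rewrite -compact_cover.
  apply=> [v Vv|x Vx]; last by exists x => //=; have [] := qP x Vx.
  exact: (open_comp (fun x _ => cq v Vv x) (@open_gt R 1)).
move=> [D DV cover_V].
have DV' v : v \in finmap.enum_fset D -> V v by move=> vD; have := DV v vD; rewrite inE.
pose s := finmap.enum_fset D.
have sV v : v \in s -> V v by exact: DV'.
pose Q x := \sum_(v <- s) pospow k.+1 (q v) x.
have CQ : Ck_on k setT Q.
  rewrite /Q; elim: (s) sV => [|v s' IH] sV.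
    by apply: eq_Ck_on (Ck_on_cst k setT 0) => [|x _]; [exact: openT|rewrite big_nil].
  have Cv : Ck_on k setT (pospow k.+1 (q v)).
    by apply: Ck_on_pospow => //; [exact: openT|have [] := qP v (sV v (mem_head _ _))].
  have Cs := IH (fun w ws => sV w (mem_behead (s := v :: s') ws)).
  by apply: eq_Ck_on (Ck_onD openT Cv Cs) => [|x _]; [exact: openT|rewrite big_cons].
(* [Q] is at least 1 on [V] and is 0 near each point outside [U]; the outer positive part flattens
   it to the constant 1 wherever [Q] is at least 1. *)
exists (fun x => 1 - pospow k.+1 (fun y => 1 - Q y) x); split.
- apply: Ck_onB; [exact: openT|exact: Ck_on_cst|apply: Ck_on_pospow => //; first exact: openT].
  by apply: Ck_onB; [exact: openT|exact: Ck_on_cst|].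
- move=> x; rewrite inE => /cover_V[v /= vD qv].
  have Q1 : 1 <= Q x.
    rewrite /Q (big_rem v) //= -[leLHS]addr0 lerD//.
      by rewrite /pospow max_r ?exprn_ege1 ?ltW// (lt_trans _ qv).
    by apply: sumr_ge0 => w _; rewrite /pospow exprn_ge0// le_max lexx.
  by rewrite /pospow max_l ?subr_le0// exprS mul0r subr0.
- move=> x nUx.
  have : \forall y \near x, forall v, v \in s -> q v y <= 0.
    apply: near_all_seq => v /sV/qP[_ _ /(_ x nUx)[W [oW Wx HW]]].
    by apply: (filterS HW); exact: open_nbhs_nbhs.
  move=> /(nbhs_ballP x)[e /= e0 HW]; exists (ball x e)^°; split.
  - exact: open_interior.
  - exact: nbhsx_ballx.
  move=> y /interior_subset/HW Hy.
  have Q0 : Q y = 0.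
    rewrite /Q big1_seq// => v /andP[_ vs].
    by rewrite /pospow max_l ?Hy// exprS mul0r.
  by rewrite /pospow Q0 subr0 max_r// expr1n subrr.
Qed.

Lemma Ck_global_extension k V f : compact V -> Ck k V f ->
  exists G, Ck_on k setT G /\ {in V, G =1 f}.
Proof.
move=> cV [U [F [oU VU CF Ff]]].
have [chi [Cchi chi1 chi0]] := cutoff_function k cV oU VU.
exists (fun x => chi x * F x); split; last by move=> x xV; rewrite chi1// mul1r Ff.
(* Outside [U] nothing is known about [F], so [chi] must vanish on a whole neighbourhood, where the
   product is then constant. *)
apply: Ck_on_local => x; have [Ux|nUx] := pselect (U x).
  by exists U => //; apply: Ck_onM => //; exact: Ck_on_subset Cchi.
have [W [oW Wx chiW]] := chi0 x nUx; exists W => //.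
apply: eq_Ck_on (Ck_on_cst k W 0) => // y; rewrite inE => Wy.
by rewrite chiW// mul0r.
Qed.

Lemma symmetric_extension k V f : compact V ->
  (forall (s : 'S_n) x, V x -> V (row_perm s x)) -> totally_symmetric V f ->
  Ck k V f -> exists G, [/\ Ck_on k setT G, {in V, G =1 f} &
    forall (s : 'S_n) x, G (row_perm s x) = G x].
Proof.
move=> cV Vs fs /(Ck_global_extension cV)[G [CG Gf]].
exists (fun x => (n`!%:R)^-1 * \sum_(s <- index_enum 'S_n) G (row_perm s x)); split.
- apply: Ck_onZ; first exact: openT.
  by apply: Ck_on_sum => [|s]; [exact: openT|exact: Ck_on_row_perm].
- move=> x; rewrite inE => Vx; rewrite (eq_bigr (fun=> f x)) => [|s _]; last first.
    by rewrite Gf ?fs// inE; exact: Vs.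
  by rewrite sumr_const card_Sn -[f x *+ _]mulr_natl mulKf// pnatr_eq0 -lt0n fact_gt0.
- move=> s x; congr (_ * _); rewrite [RHS](reindex_inj (mulIg s)) /=.
  by apply: eq_bigr => t _; rewrite row_permM.
Qed.

End Extension.

Section CartesianPower.
Context {R : realType} {n d : nat}.
Local Notation Mat := 'M[R]_(n, d).
Implicit Types (Omega : set 'rV[R]_d).

Lemma compact_in_box (V : set Mat) : compact V -> exists2 L, 0 < L & V `<=` box L.
Proof.
move=> cV.
have /choice[C HC] : forall c, exists C, forall x, V x -> `|coord c x| <= C.
  by move=> c; exact: (@compact_bounded_image R Mat V (coord c) cV (@continuous_coord R n d c)).
exists (1 + \sum_c `|C c|) => [|x Vx c].
  by rewrite ltr_wpDr// sumr_ge0.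
rewrite (le_trans (HC c x Vx))// (le_trans (ler_norm _))// (bigD1 c)//= addrCA lerDl.
by rewrite addr_ge0// sumr_ge0.
Qed.

Lemma compact_cpower Omega : compact Omega -> compact (@cpower R n d Omega).
Proof.
move=> cO.
have rc i : continuous (row i : Mat -> 'rV[R]_d).
  move=> x A /= /(nbhs_ballP (row i x)) [e e0 eA].
  apply/nbhs_ballP; exists e => // y [_ xy]; apply: eA; split => // a j.
  by rewrite !mxE; exact: xy.
have clO : closed Omega by apply: compact_closed => //; exact: norm_hausdorff.
have /choice[C HC] : forall j, exists C, forall r, Omega r -> `|r 0 j| <= C.
  move=> j; apply: (@compact_bounded_image R 'rV[R]_d Omega (fun r => r 0 j) cO).
  exact: coord_continuous.
pose L := \sum_j `|C j|.
apply: (subclosed_compact _ (@compact_box R n d L)) => [|x Vx c].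
  rewrite (_ : cpower Omega = \bigcap_(i in setT) (row i @^-1` Omega)).
    by apply: closed_bigI => i _; apply: closed_comp => // x _; exact: rc.
  by apply/seteqP; split => [x H i _|x H i]; [exact: H|exact: (H i Logic.I)].
have := HC c.2 _ (Vx c.1); rewrite mxE => /le_trans; apply.
by rewrite (le_trans (ler_norm _))// /L (bigD1 c.2)//= lerDl sumr_ge0.
Qed.

End CartesianPower.

(** * From uniform bounds on partial derivatives to the norm *)

Section CkNorm.
Context {R : realType} {n d : nat}.
Local Notation I := ('I_n * 'I_d)%type.
Local Notation Mat := 'M[R]_(n, d).
Implicit Types (F G : Mat -> R) (a : I -> nat) (ds : seq I).

(** The list follows the order in which [mderive] takes the partial derivatives, so translating
    multi-indices into lists involves no exchange of derivatives. *)
Definition directions a : seq I := flatten [seq nseq (a c) c | c <- enum {: I}].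

Lemma size_directions a : size (directions a) = (\sum_c a c)%N.
Proof.
rewrite size_flatten /shape -map_comp sumnE big_map big_enum.
by apply: eq_bigr => c _; rewrite /= size_nseq.
Qed.

Lemma mderive_partials a F : mderive a F = partials F (directions a).
Proof.
rewrite /mderive /directions; elim: (enum _) => //= c s ->.
rewrite /partials foldr_cat; elim: (a c) => //= m ->.
by [].
Qed.

Lemma partialsB k F G ds : (size ds <= k)%N -> Ck_on k setT F -> Ck_on k setT G ->
  partials (fun x => F x - G x) ds = (fun x => partials F ds x - partials G ds x).
Proof.
elim/last_ind: ds k F G => // ds c IH k F G.
rewrite size_rcons; case: k => // k sk [_ /(_ c)[dF CF]] [_ /(_ c)[dG CG]].
rewrite /partials !foldr_rcons -[RHS](IH k _ _ sk CF CG); congr foldr.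
apply/funext => x; rewrite /partial deriveB//; [exact: dF|exact: dG].
Qed.

Lemma mderive_bernstein_approx (L : R) k G (e : R) : 0 < L -> Ck_on k setT G -> 0 < e ->
  exists2 M, Ck_on k setT (bernstein L M (fun=> M) (enum {: I}) G) &
    forall b : {ffun I -> 'I_k.+1}, (Defs.order b <= k)%N -> forall x, box L x ->
   `|mderive (fun c => b c) (fun y => G y - bernstein L M (fun=> M) (enum {: I}) G y) x| <= e.
Proof.
move=> L0 CG e0.
have : \forall M \near \oo, (0 < M)%N /\ (k <= M)%N /\ forall b : {ffun I -> 'I_k.+1},
    (Defs.order b <= k)%N -> forall x, box L x ->
    `|partials (bernstein L M (fun=> M) (enum {: I}) G) (directions (fun c => b c)) x
      - partials G (directions (fun c => b c)) x| <= e.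
  have H1 : \forall M \near \oo, (0 < M)%N by exact: nbhs_infty_gt.
  have H2 : \forall M \near \oo, (k <= M)%N by exact: nbhs_infty_ge.
  have H3 : \forall M \near \oo, forall b : {ffun I -> 'I_k.+1},
    (Defs.order b <= k)%N -> forall x, box L x ->
    `|partials (bernstein L M (fun=> M) (enum {: I}) G) (directions (fun c => b c)) x
      - partials G (directions (fun c => b c)) x| <= e.
    (* The multi-indices form a finite type, so one [M] serves all of them. *)
    apply: filter_forall => b; have [bk|bk] := leqP (Defs.order b) k.
      have := @bernstein_approx R n d L k G (directions (fun c => b c)) e L0 _ CG e0.
      rewrite size_directions => /(_ bk); apply: filterS => M HM _; exact: HM.
    exact: filterE.
  near=> M; split; [|split]; by near: M.
move=> /filter_ex[M [M0 [kM HM]]]; 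
have cG : continuous G by move=> y; exact: Ck_on_continuous CG _.
have CE : Ck_on k setT (bernstein L M (fun=> M) (enum {: I}) G).
  have inI c : c \in enum {: I} by rewrite mem_enum.
  have CE1 := Ck_on_bernstein L0 M0 (enum_uniq _) inI 1 (m := fun=> M) cG (fun=> kM).
  by apply: eq_Ck_on CE1 => [|y _]; [exact: openT|rewrite mul1r].
exists M => // b bk x bx.
have sb : (size (directions (fun c => b c)) <= k)%N by rewrite size_directions.
by rewrite mderive_partials (partialsB sb CG CE) distrC; exact: HM.
Unshelve. all: by end_near. Qed.

(** The norm is an infimum, so a single extension bounds it from above. The successor in the
    denominator makes the inequality for the sum strict. *)
Lemma Ck_norm_lt k (V : set Mat) f U F (e : R) : 0 < e ->
  Ck_extension k V f U F ->
  (forall b : {ffun I -> 'I_k.+1}, (Defs.order b <= k)%N -> forall x, V x ->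
     `|mderive (fun c => b c) F x| <= e / #|{ffun I -> 'I_k.+1}|.+1%:R) ->
  (Ck_norm k V f < e%:E)%E.
Proof.
move=> e0 ext H; set N := #|{ffun I -> 'I_k.+1}| in H *.
have eN : 0 <= e / N.+1%:R by rewrite divr_ge0// ltW.
apply: (@le_lt_trans _ _ (Ck_sum k V F)%:E).
  by apply: ereal_inf_lbound; exists (U, F).
rewrite lte_fin; apply: (@le_lt_trans _ _ (\sum_(b : {ffun I -> 'I_k.+1}) e / N.+1%:R)).
  rewrite /Ck_sum big_mkcond; apply: ler_sum => b _; case: ifP => // bk.
  (* [ge_sup] asks for a nonempty set; over the empty set the supremum is 0 by convention. *)
  have [->|/set0P[x Vx]] := eqVneq V set0; first by rewrite image_set0 sup0.
  apply: ge_sup; first by exists `|mderive (fun c => b c) F x|, x.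
  by move=> _ [y Vy <-]; exact: H.
rewrite sumr_const -/N -[e / _ *+ _]mulr_natr mulrAC ltr_pdivrMr ?ltr0n//.
by rewrite ltr_pM2l// ltr_nat.
Qed.

End CkNorm.

Theorem mainTheorem4 (R : realType) (n d : nat) :
  (2 <= n)%N -> (1 <= d)%N ->
  exists phi : 'rV[R]_d -> 'rV[R]_('C(n + d, d)),
    monomial_map n phi /\
    forall (k : nat) (Omega : set 'rV[R]_d) (f : 'M[R]_(n, d) -> R) (eps : R),
      compact Omega ->
      totally_symmetric (cpower Omega) f ->
      Ck k (cpower Omega) f ->
      0 < eps ->
      exists rho : mpoly.mpoly 'C(n + d, d) R,
        let P x := poly_eval rho (\sum_(i < n) phi (row i x)) in
        (Ck_norm k (cpower Omega) (fun x => f x - P x)%R < eps%:E)%E.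
Proof.
move=> _ _; have [phi mphi] := exists_monomial_map R n d.
exists phi; split=> // k Omega f eps cO fs Cf eps0.
have cV := @compact_cpower R n d Omega cO.
have Vs (s : 'S_n) x : cpower Omega x -> cpower Omega (row_perm s x).
  by move=> Vx i; rewrite (_ : row i _ = row (s i) x)//; apply/rowP => j; rewrite !mxE.
have [G [CG Gf symG]] := symmetric_extension cV Vs fs Cf.
have [L L0 VL] := compact_in_box cV.
pose N := #|{ffun 'I_n * 'I_d -> 'I_k.+1}|.
have e0 : 0 < eps / N.+1%:R by rewrite divr_gt0.
have [M CE HM] := mderive_bernstein_approx L0 CG e0.
set E := bernstein L M (fun=> M) (enum {: 'I_n * 'I_d}) G in CE HM.
have symE (s : 'S_n) x : E (row_perm s x) = E x by exact: bernstein_symmetric.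
have [rho rhoE] := pis_symmetric mphi (sep_span_bernstein L M (fun=> M) G) symE.
exists rho => /=.
(* Values of [f] off the power of [Omega] are arbitrary, so the extension is built from [G]. It
   agrees with [f - P] on the power because [rhoE] identifies [E] with [P] everywhere. *)
apply: (@Ck_norm_lt R n d k _ _ setT (fun x => G x - E x)) => //; last first.
  by move=> b bk x /VL; exact: HM.
split=> //; [exact: openT|by apply: Ck_onB => //; exact: openT|].
by move=> x xV; rewrite /E /= Gf// rhoE.
Qed.
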